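(* For every integer $n\geq1$, the symbolic dynamical system $\mathcal{X}_{\mathcal{P}_n,R_n}$ corresponding to $\mathcal{P}_n,R_n$ is equal to the metallic mean Wang shift $\Omega_n$: $$\Omega_n=\mathcal{X}_{\mathcal{P}_n,R_n}.$$ In particular, $\mathcal{P}_n$ is a Markov partition for the dynamical system given by the $\mathbb{Z}^2$-action $R_n$ on $\mathbb{T}^2$.
   Context: **Wang tiles.** A Wang tile is a 4-tuple $\tau=(a,b,c,d)$ of labels, where $a=\mathrm{Right}(\tau)$, $b=\mathrm{Top}(\tau)$, $c=\mathrm{Left}(\tau)$, $d=\mathrm{Bottom}(\tau)$ are the labels of the right, top, left and bottom edges of a unit square. For a finite set $\mathcal{T}$ of Wang tiles, a configuration $w:\mathbb{Z}^2\to\mathcal{T}$ is valid if $\mathrm{Right}(w_{m})=\mathrm{Left}(w_{m+(1,0)})$ and $\mathrm{Top}(w_{m})=\mathrm{Bottom}(w_{m+(0,1)})$ for every $m\in\mathbb{Z}^2$. The Wang shift $\Omega_{\mathcal{T}}$ is the set of all valid configurations $\mathbb{Z}^2\to\mathcal{T}$; the shift action is $(\sigma^{k}w)_m=w_{m+k}$. The reflection of $\tau=(a,b,c,d)$ is $\widehat{\tau}=(b,a,d,c)$, and $\widehat{S}=\{\widehat\tau:\tau\in S\}$. **Metallic mean Wang shift.** Define the tiles (right, top, left, bottom): - $w_n^{i,j}=((1,1,i+1),(1,1,j+1),(1,1,i),(1,1,j))$, - $b_n^i=((0,0,i+1),(1,1,1),(0,0,i),(1,1,n))$, - $y_n^i=((0,1,i+1),(1,1,2),(0,1,i),(1,1,n+1))$,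 - $g_n^i=((0,1,i+1),(1,1,1),(0,0,i),(1,1,n+1))$, - $j_n^{k,\ell,r,s}=((0,k,\ell),(0,r,s),(0,s,r+n),(0,\ell,k+n))$. Let $W_n=\{w_n^{i,j}:1\le i,j\le n\}$, $Y_n=\{y_n^i:1\le i\le n\}$, $G_n=\{g_n^i:0\le i\le n\}$, $B_n=\{b_n^i:0\le i\le n-1\}$, and $J_n=\{j_n^{k,\ell,r,s}: (k,\ell),(r,s)\in\{(0,0),(0,1),(1,1)\}\}\setminus\{j_n^{0,0,1,1},j_n^{1,1,0,0}\}$. Then $\mathcal{T}_n=W_n\cup Y_n\cup\widehat{Y_n}\cup G_n\cup\widehat{G_n}\cup B_n\cup\widehat{B_n}\cup J_n$ and $\Omega_n=\Omega_{\mathcal{T}_n}$. **Action and partition.** Let $\beta=\frac{n+\sqrt{n^2+4}}{2}$ be the positive root of $x^2-nx-1$, $\mathbb{T}^2=\mathbb{R}^2/\mathbb{Z}^2$ (identified with $[0,1)^2$ as a set), and $R_n^{k}(x)=x+\beta k$ for $k\in\mathbb{Z}^2$, $x\in\mathbb{T}^2$. Define $\Lambda_n:[0,1)^2\to\mathbb{Z}^3$ by $$\Lambda_n(x,y)=\left(\lfloor y-\beta^{-1}+1\rfloor,\ \lfloor \beta^{-1}x+y-\beta^{-1}+1\rfloor,\ \lfloor \beta x+y-\beta^{-1}+1\rfloor\right).$$ With $\{x\}=x-\lfloor x\rfloor$, let $\mathrm{Tile}_n(x,y)$ be the Wang tile with right label $\Lambda_n(\{x\},\{y\})$, top label $\Lambda_n(\{y\},\{x\})$,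 left label $\Lambda_n(\{x-\beta^{-1}\},\{y\})$ and bottom label $\Lambda_n(\{y-\beta^{-1}\},\{x\})$; it is a $\mathbb{Z}^2$-periodic function of $(x,y)\in\mathbb{R}^2$, hence defined on $\mathbb{T}^2$, with values in $\mathcal{T}_n$. For $t\in\mathcal{T}_n$ let $P_t$ be the interior of $\mathrm{Tile}_n^{-1}(t)\subset\mathbb{T}^2$. Then $\mathcal{P}_n=\{P_t\}_{t\in\mathcal{T}_n}$ is a topological partition of $\mathbb{T}^2$ (disjoint open sets whose closures cover $\mathbb{T}^2$). **Symbolic dynamical system.** For a topological partition $\mathcal{P}=\{P_a\}_{a\in\mathcal{A}}$ of $\mathbb{T}^2$ indexed by a finite set $\mathcal{A}$ and a $\mathbb{Z}^2$-action $R$ on $\mathbb{T}^2$, a pattern $w\in\mathcal{A}^S$ with $S\subset\mathbb{Z}^2$ finite is allowed if $\bigcap_{k\in S}R^{-k}(P_{w_k})\neq\varnothing$. The symbolic dynamical system $\mathcal{X}_{\mathcal{P},R}\subseteq\mathcal{A}^{\mathbb{Z}^2}$ is the set of all $x\in\mathcal{A}^{\mathbb{Z}^2}$ such that for every $m\in\mathbb{Z}^2$ and every finite $S\subset\mathbb{Z}^2$ the restriction of $\sigma^m(x)$ to $S$ is allowed. For $w\in\mathcal{X}_{\mathcal{P},R}$ and $m\ge0$ let $D_m(w)=\bigcap_{\|k\|\le m}R^{-k}(P_{w_k})$, where $\|k\|=|k_1|+|k_2|$. The partition $\mathcal{P}$ gives a symbolic representation of $R$ if for every $w\in\mathcal{X}_{\mathcal{P},R}$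 the intersection $\bigcap_{m\ge0}\overline{D_m(w)}$ consists of exactly one point. **Markov partition.** $\mathcal{P}$ is a Markov partition for the $\mathbb{Z}^2$-action $R$ on $\mathbb{T}^2$ if $\mathcal{P}$ gives a symbolic representation of $R$ and $\mathcal{X}_{\mathcal{P},R}$ is a shift of finite type (i.e. it is the set of configurations avoiding some finite set of forbidden finite patterns). *)

(* Defs.v *)
From HB Require Import structures.
From mathcomp Require Import all_boot all_order all_algebra generic_quotient.
From mathcomp Require Import finmap.
From mathcomp Require Import all_classical all_reals all_analysis.

Set Implicit Arguments.
Unset Strict Implicit.
Unset Printing Implicit Defensive.

Import Order.TTheory GRing.Theory Num.Theory.
Import numFieldNormedType.Exports.

Local Open Scope classical_set_scope.
Local Open Scope ring_scope.

Definition Z2 : zmodType := (int * int)%type.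

Section Configurations.
Variable A : finType.

Definition config := Z2 -> A.

Definition shift (k : Z2) (w : config) : config := fun m => w (m + k).

(* A pattern w in A^S, with S a finite subset of Z^2, is a finite map of
   support [domf w] = S. *)
Definition pattern := {fmap Z2 -> A}.

Definition restriction (w : config) (S : {fset Z2}) : pattern :=
  [fmap k : S => w (val k)].

Definition occurs (p : pattern) (w : config) : Prop :=
  exists m : Z2, restriction (shift m w) (domf p) = p.

Definition shift_of_finite_type (X : set config) : Prop :=
  exists F : {fset pattern}, X = [set w | forall p, p \in F -> ~ occurs p w].

End Configurations.

Record Z2action (T : Type) := Z2Action {
  act :> Z2 -> T -> T ;
  act0 : forall x, act 0 x = x ;
  actD : forall k l x, act (k + l) x = act k (act l x)
}.

Section SymbolicDynamics.
Variables (T : topologicalType) (A : finType).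
Variables (P : A -> set T) (f : Z2action T).

Definition topological_partition : Prop :=
  [/\ forall a, open (P a),
      forall a b, a <> b -> P a `&` P b = set0 &
      \bigcup_a closure (P a) = setT].

(* [f (- k) @` _] is the image under R^{-k}. *)
Definition allowed (w : pattern A) : Prop :=
  \bigcap_(k in [set: domf w]) (f (- val k) @` P (w k)) !=set0.

Definition symbolic_system : set (config A) :=
  [set x | forall (m : Z2) (S : {fset Z2}), allowed (restriction (shift m x) S)].

Definition norm1 (k : Z2) : nat := (`|k.1| + `|k.2|)%N.

(* The set D_m(w). *)
Definition cylinder (w : config A) (m : nat) : set T :=
  \bigcap_(k in [set k | (norm1 k <= m)%N]) (f (- k) @` P (w k)).

Definition symbolic_representation : Prop :=
  forall w, symbolic_system w ->
    exists x : T, \bigcap_m closure (cylinder w m) = [set x].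

Definition markov_partition : Prop :=
  [/\ topological_partition, symbolic_representation &
      shift_of_finite_type symbolic_system].

End SymbolicDynamics.

Section WangTiles.
Variable L : choiceType.

Definition tile : choiceType := (L * L * L * L)%type.

Definition mk_tile (a b c d : L) : tile := (a, b, c, d).
Definition right (t : tile) : L := t.1.1.1.
Definition top (t : tile) : L := t.1.1.2.
Definition left (t : tile) : L := t.1.2.
Definition bottom (t : tile) : L := t.2.

Definition reflect_tile (t : tile) : tile :=
  mk_tile (top t) (right t) (bottom t) (left t).

Definition reflect_set (S : {fset tile}) : {fset tile} :=
  [fset reflect_tile t | t in S]%fset.

Definition wang_shift (S : {fset tile}) : set (config S) :=
  [set w | forall m : Z2,
     right (val (w m)) = left (val (w (m + (1, 0)))) /\
     top (val (w m)) = bottom (val (w (m + (0, 1))))].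

End WangTiles.

(* Labels of the metallic mean tiles are vectors of Z^3, to be compared with
   the values of [Lambda] below. *)
Definition label : choiceType := (int * int * int)%type.

Section MetallicMeanTiles.
Variable n : nat.
Local Open Scope nat_scope.

Definition lab (a b c : nat) : label := (Posz a, Posz b, Posz c).

Definition w_tile (i j : nat) : tile label :=
  mk_tile (lab 1 1 i.+1) (lab 1 1 j.+1) (lab 1 1 i) (lab 1 1 j).
Definition b_tile (i : nat) : tile label :=
  mk_tile (lab 0 0 i.+1) (lab 1 1 1) (lab 0 0 i) (lab 1 1 n).
Definition y_tile (i : nat) : tile label :=
  mk_tile (lab 0 1 i.+1) (lab 1 1 2) (lab 0 1 i) (lab 1 1 n.+1).
Definition g_tile (i : nat) : tile label :=
  mk_tile (lab 0 1 i.+1) (lab 1 1 1) (lab 0 0 i) (lab 1 1 n.+1).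
Definition j_tile (k l r s : nat) : tile label :=
  mk_tile (lab 0 k l) (lab 0 r s) (lab 0 s (r + n)) (lab 0 l (k + n)).

(* [iota m p] lists m, m + 1, ..., m + p - 1. *)
Definition W_tiles : {fset tile label} :=
  [fset w_tile i j | i in iota 1 n, j in iota 1 n]%fset.
Definition Y_tiles : {fset tile label} := [fset y_tile i | i in iota 1 n]%fset.
Definition G_tiles : {fset tile label} := [fset g_tile i | i in iota 0 n.+1]%fset.
Definition B_tiles : {fset tile label} := [fset b_tile i | i in iota 0 n]%fset.

Definition junction_pairs : seq (nat * nat) := [:: (0, 0); (0, 1); (1, 1)].

Definition J_tiles : {fset tile label} :=
  ([fset j_tile kl.1 kl.2 rs.1 rs.2 |
      kl in junction_pairs, rs in junction_pairs]
   `\` [fset j_tile 0 0 1 1; j_tile 1 1 0 0])%fset.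

Definition metallic_tiles : {fset tile label} :=
  (W_tiles `|` Y_tiles `|` reflect_set Y_tiles
     `|` G_tiles `|` reflect_set G_tiles
     `|` B_tiles `|` reflect_set B_tiles `|` J_tiles)%fset.

Definition metallic_wang_shift : set (config metallic_tiles) :=
  wang_shift (S := metallic_tiles).

End MetallicMeanTiles.

Arguments metallic_wang_shift n _ : clear implicits.

Section Torus.
Variable R : realType.

Definition congrZ2 (p q : R * R) : bool :=
  (p.1 - q.1 \is a Num.int) && (p.2 - q.2 \is a Num.int).

Lemma congrZ2_refl : reflexive congrZ2.
Proof. by move=> p; rewrite /congrZ2 !subrr !rpred0. Qed.

Lemma congrZ2_sym : symmetric congrZ2.
Proof.
by move=> p q; rewrite /congrZ2 -(opprB q.1) -(opprB q.2) !rpredN.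
Qed.

Lemma congrZ2_trans : transitive congrZ2.
Proof.
move=> q p r /andP[h1 h2] /andP[h3 h4]; apply/andP; split.
- by rewrite -(subrKA q.1) rpredD.
- by rewrite -(subrKA q.2) rpredD.
Qed.

Canonical congrZ2_equiv :=
  EquivRel congrZ2 congrZ2_refl congrZ2_sym congrZ2_trans.

(* T^2 = R^2 / Z^2 with the quotient of the product topology of R^2. *)
Definition torus := quotient_topology {eq_quot congrZ2_equiv}%qT.

HB.instance Definition _ := Topological.on torus.
HB.instance Definition _ := Quotient.on torus.

Definition torus_pi (p : R * R) : torus := \pi_torus%qT p.

Lemma torus_piP (p q : R * R) : torus_pi p = torus_pi q <-> congrZ2 p q.
Proof.
by split=> [/(@eqquotP _ _ {eq_quot congrZ2_equiv}%qT)
           |/(@eqquotP _ _ {eq_quot congrZ2_equiv}%qT)].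
Qed.

Lemma torus_reprK (x : torus) : torus_pi (repr x) = x.
Proof. exact: reprK. Qed.

Lemma congrZ2_repr (p : R * R) : congrZ2 (repr (torus_pi p)) p.
Proof. by apply/torus_piP; rewrite torus_reprK. Qed.

End Torus.

Section MetallicMean.
Variables (R : realType) (n : nat).

Definition beta : R := (n%:R + Num.sqrt (n%:R ^+ 2 + 4)) / 2.

Definition translate (k : Z2) (p : R * R) : R * R :=
  (p.1 + beta * k.1%:~R, p.2 + beta * k.2%:~R).

(* [repr x] is an arbitrary lift of x to R^2; the choice is irrelevant
   by [rotation_fun_pi]. *)
Definition rotation_fun (k : Z2) (x : torus R) : torus R :=
  torus_pi (translate k (repr x)).

Lemma rotation_fun_pi (k : Z2) (p : R * R) :
  rotation_fun k (torus_pi p) = torus_pi (translate k p).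
Proof.
apply/torus_piP; have /andP[h1 h2] := congrZ2_repr p.
have addK (a b c : R) : a + c - (b + c) = a - b.
  by rewrite opprD addrACA subrr addr0.
by apply/andP; rewrite /translate /= !addK.
Qed.

Lemma rotation_fun0 (x : torus R) : rotation_fun 0 x = x.
Proof.
rewrite -[x]torus_reprK rotation_fun_pi; congr torus_pi.
by case: (repr x) => a b; rewrite /translate /= !mulr0 !addr0.
Qed.

Lemma rotation_funD (k l : Z2) (x : torus R) :
  rotation_fun (k + l) x = rotation_fun k (rotation_fun l x).
Proof.
rewrite -[x]torus_reprK !rotation_fun_pi; congr torus_pi.
by rewrite /translate /= !intrD !mulrDr [beta * k.1%:~R + _]addrC [beta * k.2%:~R + _]addrC !addrA.
Qed.

Definition rotation : Z2action (torus R) :=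
  Z2Action rotation_fun0 rotation_funD.

Definition frac (x : R) : R := x - (Num.floor x)%:~R.

(* Used only for x, y in [0, 1). *)
Definition Lambda (x y : R) : label :=
  (Num.floor (y - beta^-1 + 1),
   Num.floor (beta^-1 * x + y - beta^-1 + 1),
   Num.floor (beta * x + y - beta^-1 + 1)).

Definition Tile (p : R * R) : tile label :=
  let: (x, y) := p in
  mk_tile (Lambda (frac x) (frac y))
          (Lambda (frac y) (frac x))
          (Lambda (frac (x - beta^-1)) (frac y))
          (Lambda (frac (y - beta^-1)) (frac x)).

Lemma frac_congr (x y : R) : x - y \is a Num.int -> frac x = frac y.
Proof.
move=> /intrP[z xyz]; have -> : x = y + z%:~R by rewrite -xyz addrC subrK.
by rewrite /frac floorDrz ?intr_int // intrKfloor intrD opprD addrACA subrr addr0.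
Qed.

Lemma Tile_congr (p q : R * R) : congrZ2 p q -> Tile p = Tile q.
Proof.
case: p q => [a b] [c d] /andP[/= h1 h2]; rewrite /Tile.
rewrite (frac_congr h1) (frac_congr h2).
rewrite (@frac_congr (a - beta^-1) (c - beta^-1)).
  rewrite (@frac_congr (b - beta^-1) (d - beta^-1)) //.
  by rewrite opprB addrA subrK.
by rewrite opprB addrA subrK.
Qed.

(* Independent of the lift [repr x] by [torus_Tile_pi]. *)
Definition torus_Tile (x : torus R) : tile label := Tile (repr x).

Lemma torus_Tile_pi (p : R * R) : torus_Tile (torus_pi p) = Tile p.
Proof. exact/Tile_congr/congrZ2_repr. Qed.

Definition metallic_partition (t : metallic_tiles n) : set (torus R) :=
  [set x : torus R | torus_Tile x = val t]°.

End MetallicMean.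

Arguments metallic_partition R n t _ : clear implicits.

(* Main.v *)
Require Import Defs.
From mathcomp Require Import all_boot all_order all_algebra finmap.
From mathcomp Require Import all_classical all_reals all_analysis.
From mathcomp Require Import zify ring lra.
Import Defs.

(* Write u = 1 / beta, so that u ^ 2 = 1 - n u.  In a valid configuration the first
   components of the labels depend only on the row or on the column, and their partial
   sums are staircases X (columns) and Y (rows).  The third components of the right and
   top labels are affine in p, q, X p, Y q up to a term V (q - X p - 1), resp.
   W (p - Y q - 1), which defines two further staircases.  Since third components are
   bounded, the slopes of X and Y determine each other by a contraction, hence all four
   staircases have slope u; comparing windows of Y and V then shows that they are
   Sturmian: X p is x + p u rounded down, up to a choice of side when x + p u is an
   integer, and likewise for Y, V, W with intercepts y, z, t.  The label bounds at the
   tiles near the corners of the partition give z = beta x + y and t = beta y + x.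
   Finally x, y, z, t belong to Z + Z u simultaneously as soon as two of them other than
   {z, t} do, and the tile set forbids the choices of sides that no direction in the
   plane realises; so (x, y) can be moved slightly to a point which codes any given
   finite window strictly.  Density of Z + Z u makes (x, y) unique modulo Z ^ 2. *)

Set Implicit Arguments.
Unset Strict Implicit.
Unset Printing Implicit Defensive.

Import Order.TTheory GRing.Theory Num.Theory.
Import numFieldNormedType.Exports.

Local Open Scope classical_set_scope.
Local Open Scope ring_scope.

(** * The metallic mean *)

Section Metallic.
Variables (R : realType) (n : nat).
Hypothesis n_gt0 : (0 < n)%N.

Local Notation beta := (beta R n).
Local Notation u := (beta^-1).

Lemma beta_sqr : beta ^+ 2 = n%:R * beta + 1.
Proof.
rewrite /Defs.beta; set s := Num.sqrt _.
have : s ^+ 2 = n%:R ^+ 2 + 4 by rewrite sqr_sqrtr // addr_ge0 // sqr_ge0.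
nra.
Qed.

Lemma beta_gt_n : n%:R < beta.
Proof.
rewrite /Defs.beta; set s := Num.sqrt _.
have hs : s ^+ 2 = n%:R ^+ 2 + 4 by rewrite sqr_sqrtr // addr_ge0 // sqr_ge0.
have s0 : 0 <= s by exact: sqrtr_ge0.
have n0 : 0 <= n%:R :> R by [].
nra.
Qed.

Lemma ge1n : 1 <= n%:R :> R.
Proof. by rewrite ler1n. Qed.

Lemma beta_gt1 : 1 < beta.
Proof. exact: le_lt_trans ge1n beta_gt_n. Qed.

Lemma betaV_gt0 : 0 < u.
Proof. by rewrite invr_gt0; apply: lt_trans ltr01 beta_gt1. Qed.

Lemma beta_mulV : beta * u = 1.
Proof. by rewrite divff // gt_eqF // (lt_trans ltr01 beta_gt1). Qed.

Lemma betaE : beta = (n%:R : R) + u.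
Proof.
have b0 := beta_gt1; have := beta_sqr; have := beta_mulV.
set b := Defs.beta R n in b0 *; set v := b^-1 => h1 h2.
have : b * (b - n%:R - v) = 0 by rewrite !mulrBr h1; lra.
by move/eqP; rewrite mulf_eq0 => /orP[]/eqP; lra.
Qed.

Lemma betaV_lt1 : u < 1.
Proof. by rewrite invf_lt1 ?beta_gt1 // (lt_trans ltr01 beta_gt1). Qed.

Lemma betaV_sqr : u * u = 1 - n%:R * u :> R.
Proof. by have := beta_mulV; rewrite {1}betaE; lra. Qed.

(* If [b * u] is an integer with [0 < b], so is [b * u * u = b - n * (b * u)],
   and [0 < b * u < b]. *)
Lemma betaV_irrational (b : int) (a : int) : b%:~R * u = a%:~R :> R -> b = 0.
Proof.
suff pos (k : nat) : forall m : nat, (m < k)%N -> forall a : int,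
    m.+1%:R * u = a%:~R :> R -> False.
  case: b => [[|m]|m] //= h; first by case: (pos m.+1 m (leqnn _) a).
  case: (pos m.+1 m (leqnn _) (- a)).
  by rewrite rmorphN /= -h NegzE rmorphN /= mulNr opprK.
elim: k => // k IH m mk {}a h.
have u0 := betaV_gt0; have u1 := betaV_lt1.
have m0 : 0 < m.+1%:R :> R by rewrite ltr0n.
have a0 : 0 < a%:~R :> R by rewrite -h mulr_gt0.
have am : a%:~R < m.+1%:R :> R by rewrite -h gtr_pMr.
case: a => [[|j]|j] in h a0 am *; rewrite ?ltxx ?NegzE // ?ltr0z // in a0 *.
have jm : (j.+1 < m.+1)%N by rewrite -(ltr_nat R).
apply: (IH j _ (m.+1%:Z - n%:Z * j.+1%:Z)); first by lia.
rewrite rmorphB rmorphM /= -[j.+1%:R]/(j.+1%:Z%:~R : R) -h.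
by rewrite -mulrA betaV_sqr; ring.
Qed.
End Metallic.

(** * The tile set *)

Section TileSet.
Variable n : nat.

(** Membership by inequalities, within reach of [lia]. In [Spec_j] the two negated conditions
    exclude exactly the junctions [0 0 1 1] and [1 1 0 0]. *)
Inductive metallic_spec : tile label -> Prop :=
| Spec_w i j of (0 < i <= n)%N & (0 < j <= n)%N : metallic_spec (w_tile i j)
| Spec_y i of (0 < i <= n)%N : metallic_spec (y_tile n i)
| Spec_yr i of (0 < i <= n)%N : metallic_spec (reflect_tile (y_tile n i))
| Spec_g i of (i <= n)%N : metallic_spec (g_tile n i)
| Spec_gr i of (i <= n)%N : metallic_spec (reflect_tile (g_tile n i))
| Spec_b i of (i < n)%N : metallic_spec (b_tile n i)
| Spec_br i of (i < n)%N : metallic_spec (reflect_tile (b_tile n i))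
| Spec_j k l r s of (k <= l <= 1)%N & (r <= s <= 1)%N
    & ~~ ((l < r) && (l < s))%N & ~~ ((s < k) && (s < l))%N :
    metallic_spec (j_tile n k l r s).

Lemma junction_pairsP k l :
  ((k, l) \in junction_pairs) = (k <= l <= 1)%N.
Proof. by case: k l => [|[|k]] [|[|l]] //=; rewrite andbF. Qed.

Lemma j_tile_inj k l r s k' l' r' s' :
  j_tile n k l r s = j_tile n k' l' r' s' ->
  [/\ k = k', l = l', r = r' & s = s'].
Proof. by case. Qed.

Lemma j_tile_exclusion (k l r s : nat) : (k <= l <= 1)%N -> (r <= s <= 1)%N ->
  ~~ ((j_tile n k l r s == j_tile n 0 0 1 1)
      || (j_tile n k l r s == j_tile n 1 1 0 0)) ->
  ~~ ((l < r) && (l < s))%N /\ ~~ ((s < k) && (s < l))%N.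
Proof.
by case: k l r s => [|[|k]] [|[|l]] [|[|r]] [|[|s]] //=;
  rewrite ?andbF ?eqxx ?orbT.
Qed.

(** The form in which [imfsetP] delivers membership in a listed range. *)
Lemma iota_fin m k i : in_mem i (mem_fin (fin_finpred (iota m k))) ->
  (m <= i < m + k)%N.
Proof. by rewrite -mem_iota. Qed.

Lemma fin_iota m k i : (m <= i < m + k)%N ->
  in_mem i (mem_fin (fin_finpred (iota m k))).
Proof. by rewrite -mem_iota. Qed.

Lemma metallicP t : reflect (metallic_spec t) (t \in metallic_tiles n).
Proof.
rewrite /metallic_tiles /reflect_set /J_tiles !in_fsetU in_fsetD in_fset2 -!orbA.
apply: (iffP idP).
- case/or4P=> [/imfset2P[i hi [j hj ->]]|/imfsetP[i hi ->]|
      /imfsetP[t' /imfsetP[i hi ->] ->]|].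
  + by constructor; [exact: iota_fin hi|exact: iota_fin hj].
  + by constructor; exact: iota_fin hi.
  + by constructor; exact: iota_fin hi.
  case/or4P=> [/imfsetP[i hi ->]|/imfsetP[t' /imfsetP[i hi ->] ->]|
      /imfsetP[i hi ->]|].
  + by constructor; exact: iota_fin hi.
  + by constructor; exact: iota_fin hi.
  + by constructor; exact: iota_fin hi.
  case/orP=> [/imfsetP[t' /imfsetP[i hi ->] ->]|].
    by constructor; exact: iota_fin hi.
  case/andP=> nj /imfset2P[[k l] hkl [[r s] hrs tE]].
  rewrite tE in nj *; have {}hkl : (k <= l <= 1)%N by rewrite -junction_pairsP.
  have {}hrs : (r <= s <= 1)%N by rewrite -junction_pairsP.
  have [h1 h2] := j_tile_exclusion hkl hrs nj; exact: Spec_j.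
- case=> [i j hi hj|i hi|i hi|i hi|i hi|i hi|i hi|k l r s hkl hrs h1 h2].
  + apply/orP; left; apply/imfset2P; exists i; first exact: fin_iota.
    by exists j => //; exact: fin_iota.
  + apply/orP; right; apply/orP; left; apply/imfsetP.
    by exists i => //; exact: fin_iota.
  + do 2 (apply/orP; right); apply/orP; left; apply/imfsetP.
    exists (y_tile n i) => //; apply/imfsetP.
    by exists i => //; exact: fin_iota.
  + do 3 (apply/orP; right); apply/orP; left; apply/imfsetP.
    by exists i => //; exact: fin_iota.
  + do 4 (apply/orP; right); apply/orP; left; apply/imfsetP.
    exists (g_tile n i) => //; apply/imfsetP.
    by exists i => //; exact: fin_iota.
  + do 5 (apply/orP; right); apply/orP; left; apply/imfsetP.
    by exists i => //; exact: fin_iota.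
  + do 6 (apply/orP; right); apply/orP; left; apply/imfsetP.
    exists (b_tile n i) => //; apply/imfsetP.
    by exists i => //; exact: fin_iota.
  + do 7 (apply/orP; right); apply/andP; split; last first.
      apply/imfset2P; exists (k, l).
        by rewrite -[in_mem _ _]/(_ \in junction_pairs) junction_pairsP.
      exists (r, s) => //.
      by rewrite -[in_mem _ _]/(_ \in junction_pairs) junction_pairsP.
    apply/negP => /orP[]/eqP/j_tile_inj[? ? ? ?]; lia.
Qed.

Definition lab0 (l : label) : int := l.1.1.
Definition lab1 (l : label) : int := l.1.2.
Definition lab2 (l : label) : int := l.2.

(* Constraints on a tile read from left to right; [column_rules n] of the
   reflected tile gives those read from bottom to top. *)
Record column_rules (t : tile label) : Prop := ColumnRules {
  right0 : lab0 (right t) = 0 \/ lab0 (right t) = 1;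
  left0E : lab0 (left t) = lab0 (right t);
  right2_ge0 : 0 <= lab2 (right t);
  right2_le : lab2 (right t) <= n%:Z + 1;
  col1_right2 : lab0 (top t) = 1 -> lab2 (right t) = lab2 (left t) + 1;
  col1_top1 : lab0 (top t) = 1 -> lab1 (top t) = 1;
  col1_bottom1 : lab0 (top t) = 1 -> lab1 (bottom t) = 1;
  col0_left2 : lab0 (top t) = 0 -> lab2 (left t) = n%:Z + lab1 (top t);
  col0_right2 : lab0 (top t) = 0 ->
    lab2 (right t) = lab0 (right t) + lab1 (bottom t);
  col0_top1 : lab0 (top t) = 0 -> lab1 (top t) = 0 \/ lab1 (top t) = 1;
  row1_right2 : lab0 (right t) = 1 -> 1 <= lab2 (right t);
  junction_right2 :
    lab0 (top t) = 0 -> lab0 (right t) = 0 -> lab2 (right t) <= 1;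
  row0_right2 : lab0 (right t) = 0 -> lab2 (right t) = 0 -> lab1 (right t) = 0
}.

Lemma metallic_column_rules t : t \in metallic_tiles n -> column_rules t.
Proof.
move=> /metallicP[i j hi hj|i hi|i hi|i hi|i hi|i hi|i hi|k l r s hkl hrs h1 h2];
  split; rewrite /right /top /left /bottom /lab0 /lab1 /lab2 /=; try lia.
Qed.

Lemma metallic_reflect_column_rules t :
  t \in metallic_tiles n -> column_rules (reflect_tile t).
Proof.
move=> /metallicP[i j hi hj|i hi|i hi|i hi|i hi|i hi|i hi|k l r s hkl hrs h1 h2];
  split; rewrite /right /top /left /bottom /lab0 /lab1 /lab2 /=; try lia.
Qed.

Lemma label_eq (a b : label) :
  lab0 a = lab0 b -> lab1 a = lab1 b -> lab2 a = lab2 b -> a = b.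
Proof. by case: a b => [[? ?] ?] [[? ?] ?]; rewrite /lab0 /lab1 /lab2 /= => -> -> ->. Qed.

Lemma column_rules_eq t t' : column_rules t -> column_rules t' ->
  lab0 (right t) = lab0 (right t') -> lab0 (top t) = lab0 (top t') ->
  lab0 (top t) = 0 \/ lab0 (top t) = 1 ->
  lab2 (right t) = lab2 (right t') -> lab2 (left t) = lab2 (left t') ->
  [/\ lab0 (left t) = lab0 (left t'), lab1 (top t) = lab1 (top t') &
      lab1 (bottom t) = lab1 (bottom t')].
Proof.
move=> c c' er et t01 er2 el2; split; first by rewrite !left0E.
- case: t01 => t0; last by rewrite !col1_top1 // -?et.
  by apply: (@addrI _ n%:Z); rewrite -!col0_left2 // -et.
- case: t01 => t0; last by rewrite !col1_bottom1 // -?et.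
  by apply: (@addrI _ (lab0 (right t))); rewrite {2}er -!col0_right2 // -et.
Qed.

(** First components of left and bottom labels repeat those of right and top. Second components are
    constant or read off third ones, according to the types of row and column, so they need not be
    tracked to identify a tile. *)
Lemma metallic_tile_eq t t' :
  t \in metallic_tiles n -> t' \in metallic_tiles n ->
  lab0 (right t) = lab0 (right t') -> lab0 (top t) = lab0 (top t') ->
  lab2 (right t) = lab2 (right t') -> lab2 (top t) = lab2 (top t') ->
  lab2 (left t) = lab2 (left t') -> lab2 (bottom t) = lab2 (bottom t') ->
  t = t'.
Proof.
move=> ht ht' er0 et0 er2 et2 el2 eb2.
have c := metallic_column_rules ht; have c' := metallic_column_rules ht'.
have d := metallic_reflect_column_rules ht.
have d' := metallic_reflect_column_rules ht'.
have [el0 et1 eb1] := column_rules_eq c c' er0 et0 (right0 d) er2 el2.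
have [eb0 er1 el1] := column_rules_eq d d' et0 er0 (right0 c) et2 eb2.
case: t t' er0 et0 er2 et2 el2 eb2 el0 et1 eb1 eb0 er1 el1 {ht ht' c c' d d'}
  => [[[a b] e] f] [[[a' b'] e'] f'].
rewrite /right /left /top /bottom /= => *.
by congr (_, _, _, _); exact: label_eq.
Qed.

End TileSet.

(** * Staircases of a valid configuration *)

Section Staircases.

Lemma int_step_ind (P : int -> Prop) :
  P 0 -> (forall p : int, P (p - 1) <-> P p) -> forall p : int, P p.
Proof.
move=> P0 Pstep; elim/int_rect => [//|k IH|k IH].
  by apply/Pstep; have -> : k.+1%:Z - 1 = k by lia.
by move/Pstep: IH; have -> : - k%:Z - 1 = - k.+1%:Z by lia.
Qed.

Lemma int_const (T : Type) (f : int -> T) :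
  (forall p : int, f (p - 1) = f p) -> forall p : int, f p = f 0.
Proof. by move=> fE; apply: int_step_ind => // p; rewrite fE. Qed.

Lemma int_primitive (f : int -> int) :
  exists F : int -> int, F 0 = 0 /\ forall p : int, F p - F (p - 1) = f p.
Proof.
exists (fun p => match p with
  | Posz k => \sum_(i < k) f i.+1%:Z
  | Negz k => - \sum_(i < k.+1) f (- i%:Z) end).
split=> [|[[|k]|k]]; first by rewrite /= big_ord0.
- by rewrite (_ : 0%:Z - 1 = Negz 0) //= big_ord0 big_ord1 opprK add0r.
- rewrite (_ : k.+1%:Z - 1 = k) /=; last by lia.
  by rewrite big_ord_recr /= addrAC subrr add0r.
- rewrite (_ : Negz k - 1 = Negz k.+1) /=; last by lia.
  by rewrite [in X in _ - X]big_ord_recr /= opprK addKr NegzE.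
Qed.

Lemma int_monotone (f : int -> int) :
  (forall p : int, 0 <= f p - f (p - 1) <= 1) ->
  forall p s : int, 0 <= s -> 0 <= f (p + s) - f p <= s.
Proof.
move=> fstep p [s|//] _; elim: s => [|s IH]; first by rewrite addr0 subrr.
have := fstep (p + s.+1); have -> : p + s.+1 - 1 = p + s by lia.
lia.
Qed.

Lemma int_crossing (f : int -> int) (k : int) :
  (forall p : int, 0 <= f p - f (p - 1) <= 1) ->
  forall p0 p1 : int, f p0 <= k -> k < f p1 ->
  exists p : int, f p = k /\ f (p + 1) = k + 1.
Proof.
move=> fstep p0 p1 h0 h1.
have [le10|lt01] := leP p1 p0.
  have := int_monotone fstep p1 (s := p0 - p1).
  have -> : p1 + (p0 - p1) = p0 by lia.
  by rewrite subr_ge0 le10 => /(_ isT); lia.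
have [s sE] : exists s : nat, p1 = p0 + s by exists `|p1 - p0|%N; lia.
elim: s => [|s IH] in p1 h1 lt01 sE *; first by move: h1; rewrite sE addr0; lia.
have [le|lt] := leP (f (p0 + s)) k.
  exists (p0 + s); have := fstep (p0 + s.+1).
  have -> : p0 + s.+1 - 1 = p0 + s by lia.
  have -> : p0 + s + 1 = p0 + s.+1 by lia.
  by rewrite -sE; lia.
case: s => [|s] in IH sE lt *; first by rewrite addr0 in lt; lia.
by apply: (IH _ lt) => //; lia.
Qed.

Lemma increments_eq (f g : int -> int) (N : nat) : f 0 = 0 ->
  (forall p : int, (`|p| <= N)%N -> g p - g (p - 1) = f p - f (p - 1)) ->
  forall p : int, (`|p| <= N)%N -> g p - g 0 = f p.
Proof.
move=> f0 fg.
have pos (i : nat) : (i <= N)%N -> g i - g 0 = f i.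
  elim: i => [|i IH] iN; first by rewrite f0 subrr.
  have := fg i.+1%:Z iN; have := IH (ltnW iN).
  by rewrite (_ : i.+1%:Z - 1 = i); lia.
have neg (i : nat) : (i <= N)%N -> g (- i%:Z) - g 0 = f (- i%:Z).
  elim: i => [|i IH] iN; first by rewrite oppr0 f0 subrr.
  have h : (`|(- i%:Z)%R| <= N)%N by rewrite abszN ltnW.
  have := fg _ h; have := IH (ltnW iN).
  by rewrite (_ : - i%:Z - 1 = - i.+1%:Z); lia.
case=> i; first exact: pos.
by rewrite NegzE abszN; exact: neg.
Qed.

Variable n : nat.

(* [A p q] and [B p q] are the right and top labels of the tile at [(p, q)]. *)
Definition labels_rules (A B : int -> int -> label) : Prop :=
  forall p q : int, column_rules n (mk_tile (A p q) (B p q) (A (p - 1) q) (B p (q - 1))).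

(** Reflection in the diagonal: [labels_rules n (transp B) (transp A)] states the rules of the
    reflected tiles, so each result about columns yields one about rows. *)
Definition transp (T : Type) (A : int -> int -> T) := fun p q => A q p.

(* In the coding of a point [(x, y)], the four staircases are
   [X p = floor (x + p / beta)], [Y q = floor (y + q / beta)],
   [V r = floor (beta x + y + r / beta)] and
   [W r = floor (beta y + x + r / beta)]. *)
Record staircases (A B : int -> int -> label) (X Y V W : int -> int) : Prop :=
  Staircases {
    stairX0 : X 0 = 0;
    stairY0 : Y 0 = 0;
    stairX : forall p q : int, X p - X (p - 1) = 1 - lab0 (B p q);
    stairY : forall p q : int, Y q - Y (q - 1) = 1 - lab0 (A p q);
    stairV : forall p q : int,
      lab2 (A p q) = V (q - X p - 1) - n%:Z * X p + p - Y q + 1;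
    stairW : forall p q : int,
      lab2 (B p q) = W (p - Y q - 1) - n%:Z * Y q + q - X p + 1
  }.

Lemma staircases_transp A B X Y V W :
  staircases A B X Y V W -> staircases (transp B) (transp A) Y X W V.
Proof.
by case=> X0 Y0 hX hY hV hW; split=> // p q;
  [exact: hY|exact: hX|exact: hW|exact: hV].
Qed.

Lemma labels_row A B : labels_rules A B ->
  forall p q : int, lab0 (A p q) = lab0 (A 0 q).
Proof.
move=> h p q; apply: (int_const (f := fun p => lab0 (A p q)) _ p) => {}p.
exact: left0E (h p q).
Qed.

(* Crossing a tile of a column of type 1 horizontally, or a tile of a column of
   type 0 diagonally, changes the third component of the right label by an amount
   that depends only on the types of the column and of the row. *)
Lemma staircase_third A B (X Y : int -> int) :
  labels_rules A B -> labels_rules (transp B) (transp A) -> X 0 = 0 ->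
  (forall p q : int, X p - X (p - 1) = 1 - lab0 (B p q)) ->
  (forall p q : int, Y q - Y (q - 1) = 1 - lab0 (A p q)) ->
  exists V : int -> int, forall p q : int,
    lab2 (A p q) = V (q - X p - 1) - n%:Z * X p + p - Y q + 1.
Proof.
(* Column 0, where [X 0 = 0], forces the value of [V]. *)
move=> hA hB X0 hX hY; exists (fun r => lab2 (A 0 (r + 1)) + Y (r + 1) - 1).
suff h p : forall q, lab2 (A p q) =
    lab2 (A 0 (q - X p)) + Y (q - X p) - n%:Z * X p + p - Y q.
  by move=> p q; rewrite h subrK; lia.
apply: (int_step_ind (P := fun p => forall q, _) _ _ p) => [q|{}p].
  by rewrite X0 mulr0 !subr0; lia.
have B01 : lab0 (B p 0) = 0 \/ lab0 (B p 0) = 1 by exact: right0 (hB 0 p).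
have BE (q : int) : lab0 (B p q) = lab0 (B p 0) by exact: labels_row hB q p.
case: B01 => B0.
- have XE : X p = X (p - 1) + 1 by have := hX p 0; rewrite B0; lia.
  have step (q : int) : lab2 (A p (q + 1)) + n%:Z =
      lab0 (A p (q + 1)) + lab2 (A (p - 1) q).
    have := col0_right2 (hA p (q + 1)).
    have := col0_left2 (hA p q).
    by rewrite /top /right /left /bottom /= addrK !BE => /(_ B0) -> /(_ B0) ->; lia.
  rewrite XE mulrDr mulr1; split=> h q.
  + have := h (q - 1); have := step (q - 1); have := hY p q; rewrite subrK.
    by rewrite (_ : q - 1 - X (p - 1) = q - (X (p - 1) + 1)); lia.
  + have := h (q + 1); have := step q; have := hY p (q + 1); rewrite addrK.
    by rewrite (_ : q + 1 - (X (p - 1) + 1) = q - X (p - 1)); lia.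
- have XE : X p = X (p - 1) by have := hX p 0; rewrite B0; lia.
  have step (q : int) : lab2 (A p q) = lab2 (A (p - 1) q) + 1.
    by apply: (col1_right2 (hA p q)); rewrite BE.
  by rewrite XE; split=> h q; have := h q; have := step q; lia.
Qed.

Lemma staircases_exist A B :
  labels_rules A B -> labels_rules (transp B) (transp A) ->
  exists X Y V W, staircases A B X Y V W.
Proof.
move=> hA hB.
have [X [X0 hX]] := int_primitive (fun p : int => 1 - lab0 (B p 0)).
have [Y [Y0 hY]] := int_primitive (fun q : int => 1 - lab0 (A 0 q)).
have {}hX (p q : int) : X p - X (p - 1) = 1 - lab0 (B p q).
  by rewrite hX; congr (_ - _); rewrite -[B p q]/(transp B q p) (labels_row hB).
have {}hY (p q : int) : Y q - Y (q - 1) = 1 - lab0 (A p q).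
  by rewrite hY (labels_row hA).
have [V hV] := staircase_third hA hB X0 hX hY.
have [W hW] := staircase_third hB hA Y0 (fun p q => hY q p) (fun p q => hX q p).
by exists X, Y, V, W; split => // p q; exact: hW.
Qed.

End Staircases.

(** * Bounds on staircases from the range of the labels *)

Section StaircaseBounds.
Variables (n : nat) (A B : int -> int -> label) (X Y V W : int -> int).
Hypotheses (hA : labels_rules n A B) (hB : labels_rules n (transp B) (transp A)).
Hypothesis st : staircases n A B X Y V W.

Lemma stair_step (p : int) : 0 <= X p - X (p - 1) <= 1.
Proof.
rewrite (stairX st p 0); have /= := right0 (hB 0 p).
by rewrite /right /= /transp; lia.
Qed.

(** The tiles at [(p, q)] and [(p + s, q + t)], with [t] the rise of [X], share the argument of [V].
    So [V] cancels from the difference of their third components, each of which lies between [0] and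
    [n + 1]. *)
Lemma stair_cross_bound (p q s : int) : 0 <= s ->
  `|s - n%:Z * (X (p + s) - X p) - (Y (q + (X (p + s) - X p)) - Y q)| <= n%:Z + 1.
Proof.
move=> s0; set t := X (p + s) - X p.
have := right2_ge0 (hA p q); have := right2_le (hA p q).
have := right2_ge0 (hA (p + s) (q + t)); have := right2_le (hA (p + s) (q + t)).
rewrite /right /= !(stairV st).
have -> : q + t - X (p + s) - 1 = q - X p - 1 by rewrite /t; lia.
by rewrite (_ : X (p + s) = t + X p) ?subrK // mulrDr; lia.
Qed.

(** Column [p + 1] has type 0, so its left labels have third component [n] or [n + 1]; along the
    column this component is [V (q - k - 1) - Y q] up to a constant. *)
Lemma stair_window_diff (k p q q' : int) : X p = k -> X (p + 1) = k + 1 ->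
  `|(V (q' - k - 1) - V (q - k - 1)) - (Y q' - Y q)| <= 1.
Proof.
move=> Xp Xp1.
have B0 (q0 : int) : lab0 (B (p + 1) q0) = 0.
  by have := stairX st (p + 1) q0; rewrite addrK Xp Xp1; lia.
have := col0_left2 (hA (p + 1) q) (B0 _).
have := col0_left2 (hA (p + 1) q') (B0 _).
have := col0_top1 (hA (p + 1) q) (B0 _).
have := col0_top1 (hA (p + 1) q') (B0 _).
rewrite /left /top /= addrK !(stairV st) Xp; lia.
Qed.

End StaircaseBounds.

(** * Sturmian staircases *)

Section Sturmian.
Variables (R : realType) (n : nat).
Hypothesis n_gt0 : (0 < n)%N.
Local Notation u := ((beta R n)^-1).

Lemma exists_expr_lt (a e : R) : 0 <= a < 1 -> 0 < e -> exists j : nat, a ^+ j < e.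
Proof.
case/andP=> a0 a1 e0.
have a_norm : `|a| < 1 by rewrite ger0_norm.
have /cvgrPdist_lt/(_ e e0)[N _ hN] := cvg_expr a_norm.
exists N; have := hN N (leqnn N).
by rewrite /= sub0r normrN; apply: le_lt_trans; exact: ler_norm.
Qed.

Lemma betaV_expr_int (j : nat) :
  exists p k : int, u ^+ j = p%:~R * u + k%:~R.
Proof.
elim: j => [|j [p [k IH]]]; first by exists 0, 1; rewrite mul0r add0r.
exists (k - n%:Z * p), p.
by rewrite exprS IH mulrDr mulrCA betaV_sqr // !rmorphB !rmorphM /=; ring.
Qed.

(** The powers of [u] are arbitrarily small elements of [Z + Z u], and the multiples of one smaller
    than [b - a] cannot jump over the interval. *)
Lemma betaV_dense (x a b : R) : a < b ->
  exists p k : int, a < x + p%:~R * u - k%:~R < b.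
Proof.
move=> ab; have u0 := betaV_gt0 R n_gt0; have u1 := betaV_lt1 R n_gt0.
have [||j hj] := @exists_expr_lt u (b - a); [by rewrite ltW|by rewrite subr_gt0|].
have e0 : 0 < u ^+ j by rewrite exprn_gt0.
have [p [k jE]] := betaV_expr_int j.
(* The first multiple that carries [x] beyond [a]. *)
set m := Num.floor ((a - x) / u ^+ j) + 1.
exists (m * p), (- (m * k)).
have -> : x + (m * p)%:~R * u - (- (m * k))%:~R = x + m%:~R * u ^+ j.
  by rewrite jE rmorphN !rmorphM /=; ring.
have /andP[h1 h2] := floor_itv ((a - x) / u ^+ j).
rewrite ler_pdivlMr // in h1; rewrite ltr_pdivrMr // in h2.
have mE : m%:~R * u ^+ j = (Num.floor ((a - x) / u ^+ j))%:~R * u ^+ j + u ^+ j.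
  by rewrite /m rmorphD mulrDl mul1r.
by rewrite mE; rewrite intrD mulrDl mul1r in h2; lra.
Qed.

(* [f q] is one of the two integers [floor (y + q u)], [ceil (y + q u) - 1]. *)
Definition intercept (f : int -> int) (y : R) : Prop :=
  forall q : int, (f q)%:~R <= y + q%:~R * u <= (f q)%:~R + 1.

(** Strictly between 0 and 1, the integer subtracted in [betaV_dense] can only be [f q]. The
    quantity [x + p u - f p] is called the offset at [p] below. *)
Lemma intercept_dense (f : int -> int) (y a b : R) : intercept f y ->
  0 <= a -> a < b -> b <= 1 ->
  exists q : int, a < y + q%:~R * u - (f q)%:~R < b.
Proof.
move=> fy a0 ab b1; have [q [k hk]] := betaV_dense y ab.
exists q; suff -> : f q = k by [].
have /andP[h1 h2] := fy q; case/andP: hk => h3 h4.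
have : (f q)%:~R < (k + 1)%:~R :> R by rewrite intrD; lra.
have : k%:~R < (f q + 1)%:~R :> R by rewrite intrD; lra.
by rewrite !ltr_int; lia.
Qed.

Definition discrepancy (f : int -> int) (p s : int) : R :=
  (f (p + s) - f p)%:~R - s%:~R * u.

(* As [1 = n u + u ^ 2], the discrepancy of a window of [X] is, up to a constant,
   [- u] times that of a window of [Y] which is not longer, and conversely. *)
Lemma discrepancy_bounded (X Y : int -> int) :
  (forall p : int, 0 <= X p - X (p - 1) <= 1) ->
  (forall p : int, 0 <= Y p - Y (p - 1) <= 1) ->
  (forall p q s : int, 0 <= s ->
    `|s - n%:Z * (X (p + s) - X p) - (Y (q + (X (p + s) - X p)) - Y q)|
      <= n%:Z + 1) ->
  (forall p q s : int, 0 <= s ->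
    `|s - n%:Z * (Y (p + s) - Y p) - (X (q + (Y (p + s) - Y p)) - X q)|
      <= n%:Z + 1) ->
  exists C : R, forall p s : int, 0 <= s ->
    `|discrepancy X p s| <= C /\ `|discrepancy Y p s| <= C.
Proof.
move=> Xm Ym XY YX.
have u0 := betaV_gt0 R n_gt0; have u1 := betaV_lt1 R n_gt0.
(* [c] bounds the error of a crossing, and [D] is the fixed point of the recursion
   [D = u D + u c]. *)
set c : R := n%:R + 1; set D := u * c / (1 - u).
have DE : u * D + u * c = D.
  have : D * (1 - u) = u * c by rewrite divfK // subr_eq0 eq_sym lt_eqF.
  by lra.
have step (f g : int -> int) (K : R) (N : int) :
    (forall p : int, 0 <= f p - f (p - 1) <= 1) ->
    (forall p q s : int, 0 <= s ->
    `|s - n%:Z * (f (p + s) - f p) - (g (q + (f (p + s) - f p)) - g q)|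
      <= n%:Z + 1) ->
    (forall p s : int, 0 <= s <= N -> `|discrepancy g p s| <= K + D) ->
    forall p s : int, 0 <= s <= N -> `|discrepancy f p s| <= u * K + D.
  move=> fm fg hg p s /andP[s0 sN].
  have := int_monotone fm p s0; have := fg p 0 s s0.
  rewrite /discrepancy; set t := f (p + s) - f p => h1 /andP[t0 ts].
  have := hg 0 t; rewrite t0 (le_trans ts sN) => /(_ isT).
  rewrite /discrepancy; set gt := g (0 + t) - g 0 in h1 * => h2.
  clearbody t gt.
  have h3 : `|s%:~R - n%:R * t%:~R - gt%:~R| <= c.
    have : (`|s - n%:Z * t - gt|%:~R : R) <= (n%:Z + 1)%:~R by rewrite ler_int.
    by rewrite intr_norm !rmorphB rmorphM intrD /=.
  have -> : t%:~R - s%:~R * u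
      = - u * (gt%:~R - t%:~R * u) - u * (s%:~R - n%:R * t%:~R - gt%:~R).
    have : u * u * t%:~R = (1 - n%:R * u) * t%:~R by rewrite betaV_sqr.
    by lra.
  rewrite (le_trans (ler_normB _ _)) // !normrM normrN (gtr0_norm u0).
  have a1 : u * `|gt%:~R - t%:~R * u| <= u * (K + D) by rewrite ler_pM2l.
  have a2 : u * `|s%:~R - n%:R * t%:~R - gt%:~R| <= u * c by rewrite ler_pM2l.
  by move: a1 a2; rewrite mulrDr; lra.
(* The trivial bound [N] on windows of length at most [N] shrinks by a factor [u] in each round,
   while [D] absorbs the errors. *)
have iter (j N : nat) : forall p s : int, 0 <= s <= N%:Z ->
    `|discrepancy X p s| <= u ^+ j * N%:R + D /\
    `|discrepancy Y p s| <= u ^+ j * N%:R + D.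
  have D0 : 0 <= D.
    by rewrite /D divr_ge0 ?subr_ge0 ?mulr_ge0 ?(ltW u1) ?(ltW u0) // /c addr_ge0.
  elim: j => [|j IH] p s sN.
    have triv (f : int -> int) : (forall p : int, 0 <= f p - f (p - 1) <= 1) ->
        `|discrepancy f p s| <= u ^+ 0 * N%:R + D.
      move=> fm; have /andP[s0 sN'] := sN.
      have := int_monotone fm p s0.
      rewrite /discrepancy; set t := f (p + s) - f p; rewrite expr0 mul1r.
      rewrite -!(ler_int R) => /andP[t0 ts].
      have sNR : s%:~R <= N%:R :> R by rewrite -[N%:R]/(N%:Z%:~R) ler_int.
      have s0R : 0 <= s%:~R :> R by rewrite ler0z.
      have su : 0 <= s%:~R * u by apply: mulr_ge0 => //; exact: ltW.
      have su1 : 0 <= s%:~R * (1 - u) by apply: mulr_ge0 => //; lra.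
      by rewrite ler_norml; lra.
    by split; exact: triv.
  pose K := u ^+ j * N%:R.
  rewrite exprS -mulrA; split.
    by refine (step X Y K N%:Z Xm XY _ p s sN) => p' s' /(IH p')[].
  by refine (step Y X K N%:Z Ym YX _ p s sN) => p' s' /(IH p')[].
exists (D + 1) => p [s|//] _.
(* The number of rounds depends on [s], so that the bound [D + 1] does not. *)
have [||j hj] := @exists_expr_lt u (s.+1%:R)^-1; first by rewrite ltW.
  by rewrite invr_gt0.
have [|h1 h2] := iter j s p s; first by rewrite lexx.
suff : u ^+ j * s%:R <= 1 by lra.
have s1 : 0 < s.+1%:R :> R by [].
rewrite (le_trans (y := u ^+ j * s.+1%:R)) //.
  by rewrite ler_wpM2l ?ler_nat // exprn_ge0 // ltW.
by rewrite -ler_pdivlMr // div1r ltW.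
Qed.

(* If one window of [f] were more than [1] away from the slope [u], all windows of
   [g] of the same length would err on the same side, and [g] would drift away. *)
Lemma window_balance (f g : int -> int) (C : R) :
  (forall p q s : int, 0 <= s ->
    `|(f (p + s) - f p) - (g (q + s) - g q)| <= 1) ->
  (forall p s : int, 0 <= s -> `|discrepancy g p s| <= C) ->
  forall p s : int, 0 <= s -> `|discrepancy f p s| <= 1.
Proof.
move=> fg gC p s s0.
have succM (N : nat) (a : int) : N.+1%:Z * a = a + N%:Z * a.
  by rewrite intS mulrDl mul1r.
have multi (N : nat) (e : int) :
    (forall q : int, e <= g (q + s) - g q) -> N%:Z * e <= g (N%:Z * s) - g 0.
  move=> he; elim: N => [|N IH]; first by rewrite !mul0r subrr.
  by rewrite !succM [s + _]addrC -[leRHS](subrKA (g (N%:Z * s))) lerD.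
have multi' (N : nat) (e : int) :
    (forall q : int, g (q + s) - g q <= e) -> g (N%:Z * s) - g 0 <= N%:Z * e.
  move=> he; elim: N => [|N IH]; first by rewrite !mul0r subrr.
  by rewrite !succM [s + _]addrC -[leLHS](subrKA (g (N%:Z * s))) lerD.
have arch (e : R) : (forall N : nat, N%:R * e <= C) -> e <= 0.
  move=> he; rewrite leNgt; apply/negP => e0.
  have C0 : 0 <= C by have := he 0%N; rewrite mul0r.
  have := archi_boundP (divr_ge0 C0 (ltW e0)).
  by rewrite ltr_pdivrMr // ltNge he.
have fgb (q : int) : g (q + s) - g q <= f (p + s) - f p + 1 /\
    f (p + s) - f p - 1 <= g (q + s) - g q.
  by have := fg p q s s0; lia.
have ms (N : nat) : 0 <= N%:Z * s by rewrite mulr_ge0.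
rewrite ler_norml; apply/andP; split.
- suff : s%:~R * u - (f (p + s) - f p + 1)%:~R <= 0.
    by rewrite /discrepancy !intrD; lra.
  apply: arch => N.
  have := multi' N (f (p + s) - f p + 1) (fun q => proj1 (fgb q)).
  rewrite -(ler_int R) rmorphM /= => h.
  have := gC 0 _ (ms N); rewrite /discrepancy ler_norml add0r rmorphM /=.
  by rewrite mulrBr mulrA; lra.
- suff : (f (p + s) - f p - 1)%:~R - s%:~R * u <= 0.
    by rewrite /discrepancy !rmorphB; lra.
  apply: arch => N.
  have := multi N (f (p + s) - f p - 1) (fun q => proj2 (fgb q)).
  rewrite -(ler_int R) rmorphM /= => h.
  have := gC 0 _ (ms N); rewrite /discrepancy ler_norml add0r rmorphM /=.
  by rewrite mulrBr mulrA; lra.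
Qed.

(** Balanced windows put every lower bound [f p - p u] on the intercept below every upper bound
    [f q + 1 - q u]; the supremum of the former lies in between. *)
Lemma intercept_exists (f : int -> int) :
  (forall p s : int, 0 <= s -> `|discrepancy f p s| <= 1) ->
  exists y, intercept f y.
Proof.
move=> fb.
have cross (p q : int) : (f p)%:~R - p%:~R * u <= (f q)%:~R + 1 - q%:~R * u.
  have [pq|/ltW qp] := leP p q.
    have := fb p (q - p); rewrite subr_ge0 pq /discrepancy addrCA subrr addr0.
    by move=> /(_ isT); rewrite ler_norml !rmorphB /= mulrBl; lra.
  have := fb q (p - q); rewrite subr_ge0 qp /discrepancy addrCA subrr addr0.
  by move=> /(_ isT); rewrite ler_norml !rmorphB /= mulrBl; lra.
pose E := [set z : R | exists p : int, z = (f p)%:~R - p%:~R * u].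
exists (sup E) => q; apply/andP; split.
- have : (f q)%:~R - q%:~R * u <= sup E.
    apply: ub_le_sup; last by exists q.
    by exists ((f 0)%:~R + 1 - 0%:~R * u) => _ [p ->]; exact: cross.
  lra.
- have : sup E <= (f q)%:~R + 1 - q%:~R * u.
    apply: ge_sup; first by exists ((f 0)%:~R - 0%:~R * u), 0.
    by move=> _ [p ->]; exact: cross.
  lra.
Qed.

End Sturmian.

(** * Intercepts of the four staircases *)

Section Intercepts.
Variables (R : realType) (n : nat).
Hypothesis n_gt0 : (0 < n)%N.
Local Notation beta := (beta R n).
Local Notation u := (beta^-1).

Section ColumnTypes.
Variables (A B : int -> int -> label) (X Y V W : int -> int).
Hypothesis hB : labels_rules n (transp B) (transp A).
Hypothesis st : staircases n A B X Y V W.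
Variable x : R.
Hypothesis hx : intercept n X x.

(** If the offset at [p] is below [u], the line at [p - 1] is still below [X p], so [X] has just
    climbed. Symmetrically, an offset above [u] means that it has not. *)
Lemma stair_col0 (p q : int) : x + p%:~R * u - (X p)%:~R < u -> lab0 (B p q) = 0.
Proof.
move=> h; have /andP[h1 _] := hx (p - 1); have := stairX st p q.
have : (0 : R) < (X p - X (p - 1))%:~R.
  by move: h1; rewrite !rmorphB /= mulrBl mul1r; lra.
by rewrite ltr0z; have := right0 (hB q p); rewrite /right /= /transp; lia.
Qed.

Lemma stair_col1 (p q : int) : u < x + p%:~R * u - (X p)%:~R -> lab0 (B p q) = 1.
Proof.
move=> h; have /andP[_ h1] := hx (p - 1); have := stairX st p q.
have : (X p - X (p - 1))%:~R < (1%:~R : R).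
  by move: h1; rewrite !rmorphB /= mulrBl mul1r; lra.
by rewrite ltr_int; have := right0 (hB q p); rewrite /right /= /transp; lia.
Qed.

End ColumnTypes.

Section OneSide.
Variables (A B : int -> int -> label) (X Y V W : int -> int).
Hypotheses (hA : labels_rules n A B) (hB : labels_rules n (transp B) (transp A)).
Hypothesis st : staircases n A B X Y V W.

Lemma staircase_discrepancy : exists C : R, forall p s : int, 0 <= s ->
  `|discrepancy R n X p s| <= C /\ `|discrepancy R n Y p s| <= C.
Proof.
apply: (discrepancy_bounded R n_gt0 (stair_step hB st)).
- exact: (stair_step hA (staircases_transp st)).
- exact: (stair_cross_bound hA st).
- exact: (stair_cross_bound hB (staircases_transp st)).
Qed.

(** Bounded discrepancy around a positive slope makes [X] unbounded in both directions, and its unit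
    steps skip no level. *)
Lemma stair_onto (k : int) : exists p : int, X p = k /\ X (p + 1) = k + 1.
Proof.
have [C hC] := staircase_discrepancy.
have u0 := betaV_gt0 R n_gt0.
have [N hN] : exists N : nat, `|k|%:~R + C + 1 < N%:R * u.
  exists (Num.Def.archi_bound (`|(`|k|%:~R + C + 1)| / u)).
  rewrite -ltr_pdivrMr //; apply: le_lt_trans (archi_boundP _).
    by apply: ler_wpM2r; [rewrite invr_ge0 ltW|exact: ler_norm].
  by rewrite divr_ge0 // ltW.
have kn : k%:~R <= `|k|%:~R :> R by rewrite ler_int; lia.
have kn' : - k%:~R <= `|k|%:~R :> R by rewrite -rmorphN ler_int; lia.
apply: (@int_crossing X k (stair_step hB st) (- N%:Z) N%:Z).
- have [|+ _] := hC (- N%:Z) N%:Z; first by [].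
  rewrite /discrepancy addNr (stairX0 st) sub0r rmorphN ler_norml /= => h.
  by rewrite -(ler_int R); lra.
- have [|+ _] := hC 0 N%:Z; first by [].
  rewrite /discrepancy add0r (stairX0 st) subr0 ler_norml /= => h.
  by rewrite -(ltr_int R); lra.
Qed.

Lemma staircase_intercepts : exists y z : R, intercept n Y y /\ intercept n V z.
Proof.
have [C hC] := staircase_discrepancy.
have VY (p q s : int) : 0 <= s -> `|(V (p + s) - V p) - (Y (q + s) - Y q)| <= 1.
  (* The level of [X] is chosen so that the window of [V] at [p] faces the window of [Y] at [q]. *)
  move=> s0; have [r [r1 r2]] := stair_onto (q - p - 1).
  have := stair_window_diff hA st q (q + s) r1 r2.
  have -> : q + s - (q - p - 1) - 1 = p + s by lia.
  by have -> : q - (q - p - 1) - 1 = p by lia.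
have YV (p q s : int) : 0 <= s -> `|(Y (p + s) - Y p) - (V (q + s) - V q)| <= 1.
  by move=> s0; rewrite distrC; exact: VY.
(* Balance goes first from the bounded discrepancy of [Y] to [V], then back from [V] to [Y]. *)
have V1 := window_balance n_gt0 VY (fun p s s0 => proj2 (hC p s s0)).
have Y1 := window_balance n_gt0 YV V1.
have [y hy] := intercept_exists Y1; have [z hz] := intercept_exists V1.
by exists y, z.
Qed.

Variables x y z : R.
Hypotheses (hx : intercept n X x) (hy : intercept n Y y) (hz : intercept n V z).

(** Splits the third component into the gap [z - (beta x + y)] and the three offsets, which are
    controlled by density. *)
Lemma stair_third_real (p q : int) (r := q - X p - 1) :
  (lab2 (A p q))%:~R = z - y - beta * x
    + beta * (x + p%:~R * u - (X p)%:~R) + (y + q%:~R * u - (Y q)%:~R)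
    - u + 1 - (z + r%:~R * u - (V r)%:~R).
Proof.
have rE : r%:~R = q%:~R - (X p)%:~R - 1 :> R by rewrite !rmorphB.
rewrite (stairV st) -/r rE; clearbody r.
rewrite !(rmorphB, rmorphD, rmorphM) /=.
have bE := betaE R n_gt0; have bu := beta_mulV R n_gt0.
have e1 : beta * (p%:~R * u) = p%:~R by rewrite mulrCA bu mulr1.
have e2 : beta * (X p)%:~R = n%:R * (X p)%:~R + u * (X p)%:~R.
  by rewrite {1}bE mulrDl.
by rewrite !mulrDr mulrN e1 e2; ring.
Qed.

(* A gap [z - (beta x + y)] of either sign contradicts a bound on the third
   component at a tile near a corner of the partition. *)
Lemma stair_intercept_third : z = beta * x + y.
Proof.
have u0 := betaV_gt0 R n_gt0; have u1 := betaV_lt1 R n_gt0.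
have b1 := beta_gt1 R n_gt0; have bu := beta_mulV R n_gt0.
have b0 : 0 < beta by lra.
case: (ltgtP z (beta * x + y)) => // ez.
(* An offset of [X] below [d] and one of [Y] between [u] and [u + d] cannot make up for the gap
   [(beta + 1) d]: the third component falls below 1 in a row of type 1. *)
- pose d := (beta * x + y - z) / (beta + 1).
  have d0 : 0 < d by rewrite divr_gt0 //; lra.
  have dE : d * (beta + 1) = beta * x + y - z by rewrite divfK // gt_eqF //; lra.
  have [||p /andP[p1 p2]] :=
      @intercept_dense _ _ n_gt0 X x 0 (Num.min d 1) hx (lexx _).
  + by rewrite lt_min d0 ltr01.
  + by rewrite ge_min lexx orbT.
  have [||q /andP[q1 q2]] :=
      @intercept_dense _ _ n_gt0 Y y u (Num.min (u + d) 1) hy (ltW u0).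
  + by rewrite lt_min u1 andbT; lra.
  + by rewrite ge_min lexx orbT.
  rewrite lt_min in p2; rewrite lt_min in q2.
  case/andP: p2 => p2 _; case/andP: q2 => q2 _.
  have := row1_right2 (hA p q) (stair_col1 hA (staircases_transp st) hy p q1).
  rewrite /right /= -(ler_int R) stair_third_real.
  have /andP[r1 r2] := hz (q - X p - 1).
  have : beta * (x + p%:~R * u - (X p)%:~R) < beta * d by rewrite ltr_pM2l.
  lra.
(* With both offsets between [u - d] and [u], a junction tile gets a third component above 1. *)
- pose d := (z - (beta * x + y)) / (beta + 1).
  have d0 : 0 < d by rewrite divr_gt0 //; lra.
  have dE : d * (beta + 1) = z - (beta * x + y) by rewrite divfK // gt_eqF //; lra.
  have mx0 : 0 <= Num.max 0 (u - d) by rewrite le_max lexx.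
  have mxu : Num.max 0 (u - d) < u by rewrite gt_max u0; lra.
  have [|p /andP[p1 p2]] := @intercept_dense _ _ n_gt0 X x _ u hx mx0 mxu.
    exact: ltW.
  have [|q /andP[q1 q2]] := @intercept_dense _ _ n_gt0 Y y _ u hy mx0 mxu.
    exact: ltW.
  rewrite gt_max in p1; rewrite gt_max in q1.
  case/andP: p1 => _ p1; case/andP: q1 => _ q1.
  have B0 := stair_col0 hB st hx q p2.
  have A0 := stair_col0 hA (staircases_transp st) hy p q2.
  have := junction_right2 (hA p q) B0 A0.
  rewrite /right /= -(ler_int R) stair_third_real.
  have /andP[r1 r2] := hz (q - X p - 1).
  have : beta * (u - d) < beta * (x + p%:~R * u - (X p)%:~R) by rewrite ltr_pM2l.
  rewrite mulrBr bu; lra.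
Qed.

End OneSide.

End Intercepts.

(** * Sides of singular intercepts *)

Section Sides.
Variables (R : realType) (n : nat).
Hypothesis n_gt0 : (0 < n)%N.
Local Notation beta := (beta R n).
Local Notation u := (beta^-1).

(* The point [x] is an end of the interval of the intercepts of a finite piece
   of [f]. *)
Definition touches_left (f : int -> int) (x : R) : Prop :=
  exists p : int, x + p%:~R * u = (f p)%:~R.
Definition touches_right (f : int -> int) (x : R) : Prop :=
  exists p : int, x + p%:~R * u = (f p)%:~R + 1.

(* Moving [x] in the direction [v] keeps it an intercept of any finite piece
   of [f]. *)
Definition inward (f : int -> int) (x v : R) : Prop :=
  (touches_left f x -> 0 < v) /\ (touches_right f x -> v < 0).

(** The ring [Z[beta]], as [beta = n + u] and [u * u = 1 - n u]. Its elements are the singular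
    intercepts, those whose line meets an integer at some index. *)
Definition in_ring (x : R) : Prop := exists k p : int, x = k%:~R + p%:~R * u.

Lemma ring_uniq (k p k' p' : int) :
  k%:~R + p%:~R * u = k'%:~R + p'%:~R * u :> R -> k = k' /\ p = p'.
Proof.
move=> e; have : (p - p')%:~R * u = (k' - k)%:~R :> R.
  by rewrite !rmorphB /= mulrBl; lra.
move/(betaV_irrational n_gt0) => /eqP; rewrite subr_eq0 => /eqP pp'.
split=> //; move: e; rewrite pp' => /addIr/eqP; rewrite eqr_int; exact/eqP.
Qed.

Lemma in_ringD x y : in_ring x -> in_ring y -> in_ring (x + y).
Proof.
move=> [k [p ->]] [k' [p' ->]]; exists (k + k'), (p + p').
by rewrite !rmorphD /=; ring.
Qed.

Lemma in_ringN x : in_ring x -> in_ring (- x).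
Proof.
by move=> [k [p ->]]; exists (- k), (- p); rewrite !rmorphN /=; ring.
Qed.

Lemma in_ringMbeta x : in_ring x -> in_ring (beta * x).
Proof.
move=> [k [p ->]]; exists (n%:Z * k + p), k.
have bu := beta_mulV R n_gt0; have bE := betaE R n_gt0.
rewrite mulrDr mulrCA bu mulr1 rmorphD rmorphM /= {1}bE; ring.
Qed.

Lemma in_ringMbetaV x : in_ring (beta * x) -> in_ring x.
Proof.
move=> [k [p e]]; exists p, (k - n%:Z * p).
have bu := beta_mulV R n_gt0.
have -> : x = u * (beta * x) by rewrite mulrA [u * _]mulrC bu mul1r.
by rewrite e mulrDr mulrCA betaV_sqr // !(rmorphB, rmorphM) /=; ring.
Qed.

Lemma touches_left_ring f x : touches_left f x -> in_ring x.
Proof.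
move=> [p e]; exists (f p), (- p); rewrite rmorphN /=; lra.
Qed.

Lemma touches_right_ring f x : touches_right f x -> in_ring x.
Proof.
move=> [p e]; exists (f p + 1), (- p); rewrite rmorphN rmorphD /=; lra.
Qed.

(** The point [k + p u] puts the line on the integer [k] at index [- p], where [f] must have chosen
    a side. *)
Lemma in_ring_touches f x : intercept n f x -> in_ring x ->
  touches_left f x \/ touches_right f x.
Proof.
move=> fx [k [p e]]; have := fx (- p); rewrite rmorphN /= e => h.
have : f (- p) = k \/ f (- p) + 1 = k.
  have /andP[h1 h2] := h.
  have : (f (- p))%:~R <= k%:~R :> R by lra.
  have : k%:~R <= (f (- p) + 1)%:~R :> R by rewrite rmorphD /=; lra.
  by rewrite !ler_int; lia.
case=> fp; [left|right]; exists (- p); rewrite rmorphN /= -fp ?rmorphD /=; lra.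
Qed.

(** By irrationality of [u], the line meets an integer at no more than one index. *)
Lemma touches_uniq f x : touches_left f x -> touches_right f x -> False.
Proof.
move=> [p e] [q e'].
have [] := @ring_uniq (f p) (- p) (f q + 1) (- q).
  by rewrite !rmorphN rmorphD /=; lra.
by move=> h /oppr_inj pq; move: h; rewrite pq; lia.
Qed.

Lemma cvg_ray (a v : R) : (a + e * v) @[e --> 0^'+] --> a.
Proof.
rewrite -[X in _ --> X]addr0 -[X in _ --> _ + X](mul0r v).
apply: cvgD; first exact: cvg_cst.
by apply: cvgM; [exact: cvg_at_right_filter cvg_id|exact: cvg_cst].
Qed.

(** Where the line avoids the two bounds, continuity suffices; where it meets one, [v] has the sign
    that moves it inside. *)
Lemma inward_strict f x v : intercept n f x -> inward f x v -> forall ps : seq int,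
  \forall e \near 0^'+, forall p : int, p \in ps ->
    (f p)%:~R < x + e * v + p%:~R * u < (f p)%:~R + 1.
Proof.
move=> fx [vl vr]; elim=> [|p ps IH]; first by near=> e.
suff one : \forall e \near 0^'+,
    (f p)%:~R < x + e * v + p%:~R * u < (f p)%:~R + 1.
  near=> e => q; rewrite inE => /orP[/eqP ->|qps]; first by near: e.
  by move: q qps; near: e.
have /andP[h1 h2] := fx p.
have lo : \forall e \near 0^'+, (f p)%:~R < x + e * v + p%:~R * u.
  move: h1; rewrite le_eqVlt => /orP[/eqP h1|h1].
    have v0 : 0 < v by apply: vl; exists p.
    near=> e; rewrite addrAC -h1 ltrDl mulr_gt0 //.
  have lo := cvgr_gt _ (@cvg_ray (x + p%:~R * u) v) _ h1.
  by near=> e; rewrite addrAC; near: e; exact: lo.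
have hi : \forall e \near 0^'+, x + e * v + p%:~R * u < (f p)%:~R + 1.
  move: h2; rewrite le_eqVlt => /orP[/eqP h2|h2].
    have v0 : v < 0 by apply: vr; exists p.
    near=> e; rewrite addrAC h2 gtrDl pmulr_rlt0 //.
  have hi := cvgr_lt _ (@cvg_ray (x + p%:~R * u) v) _ h2.
  by near=> e; rewrite addrAC; near: e; exact: hi.
by near=> e; apply/andP; split; near: e.
Unshelve. all: by end_near. Qed.

End Sides.

(** * A common inward direction for the four staircases *)

Section Directions.
Variables (R : realType) (n : nat).
Hypothesis n_gt0 : (0 < n)%N.
Local Notation beta := (beta R n).
Local Notation u := (beta^-1).

(** Writing [beta x + y] in the basis [1], [u] and using uniqueness of the coordinates locates where
    the third line meets an integer. *)
Lemma third_line (x y : R) (p q a b r c : int) :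
  x + p%:~R * u = a%:~R -> y + q%:~R * u = b%:~R ->
  beta * x + y + r%:~R * u = c%:~R ->
  r = q - a /\ c = n%:Z * a - p + b.
Proof.
move=> hp hq hr.
have bE := betaE R n_gt0; have bu := beta_mulV R n_gt0.
have hx' : beta * x = n%:R * a%:~R + a%:~R * u - p%:~R.
  have -> : x = a%:~R - p%:~R * u by lra.
  by rewrite mulrBr mulrCA bu mulr1 {1}bE; ring.
have [] := @ring_uniq R n n_gt0 (n%:Z * a - p + b) (r + a - q) c 0.
  rewrite !(rmorphB, rmorphD, rmorphM) /= mul0r addr0 -hr -hq hx'.
  by ring.
by move=> -> e; split=> //; lia.
Qed.

(* The three corner lemmas exclude the choices of sides of four lines through a
   common point that no nearby point realises. *)
Section Corners.
Variables (A B : int -> int -> label) (X Y V W : int -> int).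
Hypotheses (hA : labels_rules n A B) (hB : labels_rules n (transp B) (transp A)).
Hypothesis st : staircases n A B X Y V W.
Variables x y : R.
Hypotheses (hx : intercept n X x) (hy : intercept n Y y).

Lemma intercept_stay (f : int -> int) (t : R) (p : int) : intercept n f t ->
  t + p%:~R * u = (f p)%:~R -> f (p + 1) = f p.
Proof.
move=> ft e; have /andP[h1 h2] := ft (p + 1); move: h1 h2.
rewrite rmorphD /= mulrDl mul1r addrA e => h1 h2.
have u0 := betaV_gt0 R n_gt0; have u1 := betaV_lt1 R n_gt0.
have : (f (p + 1))%:~R < (f p + 1)%:~R :> R by rewrite rmorphD /=; lra.
have : (f p - 1)%:~R < (f (p + 1))%:~R :> R by rewrite rmorphB /=; lra.
by rewrite !ltr_int; lia.
Qed.

Lemma intercept_jump (f : int -> int) (t : R) (p : int) : intercept n f t ->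
  t + p%:~R * u = (f p)%:~R + 1 -> f (p + 1) = f p + 1.
Proof.
move=> ft e; have /andP[h1 h2] := ft (p + 1); move: h1 h2.
rewrite rmorphD /= mulrDl mul1r addrA e => h1 h2.
have u0 := betaV_gt0 R n_gt0; have u1 := betaV_lt1 R n_gt0.
have : (f (p + 1))%:~R < (f p + 2)%:~R :> R by rewrite rmorphD /=; lra.
have : (f p)%:~R < (f (p + 1))%:~R :> R by lra.
by rewrite !ltr_int; lia.
Qed.

Lemma corner_left_left : touches_left n X x -> touches_left n Y y ->
  touches_right n V (beta * x + y) -> False.
Proof.
move=> [p hp] [q hq] [r hr].
have [|rE cE] := @third_line x y p q (X p) (Y q) r (V r + 1) hp hq.
  by rewrite rmorphD.
have Yq := intercept_stay hy hq.
(* Row [q + 1] has type 1, yet the third component of this right label comes out as 0. *)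
have A1 : lab0 (A p (q + 1)) = 1.
  by have := stairY st p (q + 1); rewrite addrK Yq; lia.
have := row1_right2 (hA p (q + 1)) A1; rewrite /right /= (stairV st).
have -> : q + 1 - X p - 1 = r by lia.
by rewrite Yq; lia.
Qed.

Lemma corner_right_right : touches_right n X x -> touches_right n Y y ->
  touches_left n V (beta * x + y) -> False.
Proof.
move=> [p hp] [q hq] [r hr].
have [||rE cE] := @third_line x y p q (X p + 1) (Y q + 1) r (V r) _ _ hr.
- by rewrite rmorphD.
- by rewrite rmorphD.
have Xp := intercept_jump hx hp; have Yq := intercept_jump hy hq.
(* The tile at [(p + 1, q + 1)] is a junction, yet its right label gets third component 2. *)
have A0 : lab0 (A (p + 1) (q + 1)) = 0.
  by have := stairY st (p + 1) (q + 1); rewrite addrK Yq; lia.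
have B0 : lab0 (B (p + 1) (q + 1)) = 0.
  by have := stairX st (p + 1) (q + 1); rewrite addrK Xp; lia.
have := junction_right2 (hA (p + 1) (q + 1)) B0 A0; rewrite /right /= (stairV st).
have -> : q + 1 - X (p + 1) - 1 = r by lia.
by rewrite Yq Xp cE; lia.
Qed.

Lemma corner_left_right : touches_left n X x -> touches_right n Y y ->
  touches_right n V (beta * x + y) -> touches_left n W (beta * y + x) -> False.
Proof.
move=> [p hp] [q hq] [r hr] [s hs].
have [||rE cE] := @third_line x y p q (X p) (Y q + 1) r (V r + 1) hp.
- by rewrite rmorphD.
- by rewrite rmorphD.
have [|sE dE] := @third_line y x q p (Y q + 1) (X p) s (W s) _ hp hs.
  by rewrite rmorphD.
have Yq := intercept_jump hy hq.
have A0 : lab0 (A p (q + 1)) = 0.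
  by have := stairY st p (q + 1); rewrite addrK Yq; lia.
(* A right label with first and third components 0 has second component 0, but the third component
   [n + 1] of the bottom label requires 1. *)
have A2 : lab2 (A p (q + 1)) = 0.
  rewrite (stairV st).
  have -> : q + 1 - X p - 1 = r by lia.
  by rewrite Yq; lia.
have := row0_right2 (hA p (q + 1)) A0 A2.
have := col0_left2 (hB (q + 1) p) A0.
rewrite /left /top /right /= /transp addrK (stairW st).
have -> : p - Y q - 1 = s by lia.
by rewrite dE; lia.
Qed.

End Corners.

Variables (A B : int -> int -> label) (X Y V W : int -> int).
Hypotheses (hA : labels_rules n A B) (hB : labels_rules n (transp B) (transp A)).
Hypothesis st : staircases n A B X Y V W.
Variables x y : R.
Hypotheses (hx : intercept n X x) (hy : intercept n Y y).
Hypotheses (hV : intercept n V (beta * x + y)) (hW : intercept n W (beta * y + x)).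

Lemma not_in_ring_inward (f : int -> int) (t v : R) : ~ in_ring n t -> inward n f t v.
Proof.
by move=> h; split=> [/(touches_left_ring (n := n))|/(touches_right_ring (n := n))].
Qed.

(** If [x] and [y] are both in the ring, so are the other two intercepts. If exactly one is, the
    other two are not, and a direction along one axis works. If neither is, only [V] and [W] can
    constrain, and [beta > 1] lets unit directions realise all their signs. *)
Lemma inward_direction : exists v1 v2 : R,
  [/\ inward n X x v1, inward n Y y v2,
      inward n V (beta * x + y) (beta * v1 + v2) &
      inward n W (beta * y + x) (beta * v2 + v1)].
Proof.
have b1 := beta_gt1 R n_gt0.
have st' := staircases_transp st.
have right_in (f : int -> int) (t v : R) : touches_left n f t -> 0 < v -> inward n f t v.
  by move=> fl v0; split=> // /(touches_uniq n_gt0 fl).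
have left_in (f : int -> int) (t v : R) : touches_right n f t -> v < 0 -> inward n f t v.
  by move=> fr v0; split=> // /(touches_uniq n_gt0)/(_ fr).
have split_in (f : int -> int) (t : R) : intercept n f t ->
    [\/ touches_left n f t, touches_right n f t | ~ in_ring n t].
  move=> ft; have [rt|nt] := pselect (in_ring n t); last by constructor 3.
  by case: (in_ring_touches n_gt0 ft rt) => h; [constructor 1|constructor 2].
have [rx|nx] := pselect (in_ring n x); have [ry|ny] := pselect (in_ring n y).
- have rz : in_ring n (beta * x + y).
    by apply: in_ringD => //; exact: (in_ringMbeta n_gt0).
  have rw : in_ring n (beta * y + x).
    by apply: in_ringD => //; exact: (in_ringMbeta n_gt0).
  have cV1 := corner_left_left hA st hy (x := x).
  have cW1 := corner_left_left hB st' hx (x := y).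
  have cV2 := corner_right_right hA st hx hy.
  have cW2 := corner_right_right hB st' hy hx.
  have cV3 := corner_left_right hA hB st hy (x := x).
  have cW3 := corner_left_right hB hA st' hx (x := y).
  (* The corner lemmas leave eight of the sixteen choices of sides, one for each sector cut by the
     four lines through the point. *)
  case: (in_ring_touches n_gt0 hx rx) => tx; case: (in_ring_touches n_gt0 hy ry) => ty;
    case: (in_ring_touches n_gt0 hV rz) => tz; case: (in_ring_touches n_gt0 hW rw) => tw;
    try (by exfalso; auto).
  + by exists 1, 1; split; apply: right_in => //; lra.
  (* The factor [2 * beta] lets one coordinate dominate both combinations [beta * v1 + v2] and
     [beta * v2 + v1]. *)
  + exists (2 * beta), (- 1); split;
      [apply: right_in|apply: left_in|
       apply: right_in|apply: right_in] => //; nra.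
  + exists 1, (- 1); split;
      [apply: right_in|apply: left_in|
       apply: right_in|apply: left_in] => //; nra.
  + exists 1, (- (2 * beta)); split;
      [apply: right_in|apply: left_in|
       apply: left_in|apply: left_in] => //; nra.
  + exists (- 1), (2 * beta); split;
      [apply: left_in|apply: right_in|
       apply: right_in|apply: right_in] => //; nra.
  + exists (- 1), 1; split;
      [apply: left_in|apply: right_in|
       apply: left_in|apply: right_in] => //; nra.
  + exists (- (2 * beta)), 1; split;
      [apply: left_in|apply: right_in|
       apply: left_in|apply: left_in] => //; nra.
  + by exists (- 1), (- 1); split; apply: left_in => //; lra.
- have nz : ~ in_ring n (beta * x + y).
    move=> rz; apply: ny; have -> : y = beta * x + y - beta * x by ring.
    by apply: in_ringD => //; apply/in_ringN/(in_ringMbeta n_gt0).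
  have nw : ~ in_ring n (beta * y + x).
    move=> rw; apply/ny/(in_ringMbetaV n_gt0).
    have -> : beta * y = beta * y + x - x by ring.
    by apply: in_ringD => //; exact: in_ringN.
  case: (in_ring_touches n_gt0 hx rx) => tx.
  + by exists 1, 0; split; [exact: right_in|exact: not_in_ring_inward..].
  + exists (- 1), 0; split; [apply: left_in => //; lra|exact: not_in_ring_inward..].
- have nw : ~ in_ring n (beta * y + x).
    move=> rw; apply: nx; have -> : x = beta * y + x - beta * y by ring.
    by apply: in_ringD => //; apply/in_ringN/(in_ringMbeta n_gt0).
  have nz : ~ in_ring n (beta * x + y).
    move=> rz; apply/nx/(in_ringMbetaV n_gt0).
    have -> : beta * x = beta * x + y - y by ring.
    by apply: in_ringD => //; exact: in_ringN.
  case: (in_ring_touches n_gt0 hy ry) => ty.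
  + by exists 0, 1; split;
      [exact: not_in_ring_inward|exact: right_in|exact: not_in_ring_inward..].
  + exists 0, (- 1); split; [exact: not_in_ring_inward|apply: left_in => //; lra|
      exact: not_in_ring_inward..].
- have nX v : inward n X x v by exact: not_in_ring_inward.
  have nY v : inward n Y y v by exact: not_in_ring_inward.
  have up1 : 0 < beta * 1 + 1 by lra.
  have dn1 : beta * (- 1) + (- 1) < 0 by lra.
  have up2 : 0 < beta * 1 + (- 1) by lra.
  have dn2 : beta * (- 1) + 1 < 0 by lra.
  have [tz|tz|nz] := split_in _ _ hV; have [tw|tw|nw] := split_in _ _ hW.
  + by exists 1, 1; split; [ | | exact: right_in | exact: right_in].
  + by exists 1, (- 1); split; [ | | exact: right_in | exact: left_in].
  + by exists 1, 1; split; [ | | exact: right_in | exact: not_in_ring_inward].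
  + by exists (- 1), 1; split; [ | | exact: left_in | exact: right_in].
  + by exists (- 1), (- 1); split; [ | | exact: left_in | exact: left_in].
  + by exists (- 1), (- 1); split; [ | | exact: left_in | exact: not_in_ring_inward].
  + by exists 1, 1; split; [ | | exact: not_in_ring_inward | exact: right_in].
  + by exists (- 1), (- 1); split; [ | | exact: not_in_ring_inward | exact: left_in].
  + by exists 1, 1; split; [ | | exact: not_in_ring_inward | exact: not_in_ring_inward].
Qed.

End Directions.

(** * Tiles of points of the torus *)

Section TileValues.
Variables (R : realType) (n : nat).
Hypothesis n_gt0 : (0 < n)%N.
Local Notation beta := (beta R n).
Local Notation u := (beta^-1).

Lemma floor_unique (t : R) (k : int) :
  k%:~R <= t -> t < k%:~R + 1 -> Num.floor t = k.
Proof. by move=> h1 h2; apply: floor_def; rewrite h1 intrD. Qed.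

Lemma nonneg_floor (t : R) : 0 <= t ->
  exists i : nat, i%:R <= t < i%:R + 1.
Proof.
move=> t0; have /andP[h1 h2] := floor_itv t.
have : 0 <= Num.floor t by rewrite floor_ge0.
case: (Num.floor t) h1 h2 => // i h1 h2 _; exists i.
by rewrite h1; rewrite intrD in h2.
Qed.

Lemma Lambda_lab (x y : R) (a b c : nat) :
  a%:R <= y - u + 1 < a%:R + 1 ->
  b%:R <= u * x + y - u + 1 < b%:R + 1 ->
  c%:R <= beta * x + y - u + 1 < c%:R + 1 ->
  Lambda n x y = lab a b c.
Proof.
move=> /andP[a1 a2] /andP[b1 b2] /andP[c1 c2].
by rewrite /Lambda (@floor_unique _ a) // (@floor_unique _ b) // (@floor_unique _ c).
Qed.

Lemma frac_id (x : R) : 0 <= x < 1 -> frac x = x.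
Proof.
move=> /andP[x0 x1]; rewrite /frac (@floor_unique x 0) ?subr0 //.
by rewrite add0r.
Qed.

Lemma frac_itv (x : R) : 0 <= frac x < 1.
Proof.
rewrite /frac; have /andP[h1 h2] := floor_itv x; rewrite intrD in h2.
by apply/andP; split; lra.
Qed.

Lemma frac_shift (x : R) (k : int) : frac (x - k%:~R) = frac x.
Proof. by apply: frac_congr; rewrite addrAC subrr add0r rpredN intr_int. Qed.

Lemma Tile_reflect (x y : R) : Tile n (y, x) = reflect_tile (Tile n (x, y)).
Proof. by []. Qed.

Lemma metallic_reflect t :
  t \in metallic_tiles n -> reflect_tile t \in metallic_tiles n.
Proof.
move=> /metallicP[i j hi hj|i hi|i hi|i hi|i hi|i hi|i hi|k l r s hkl hrs h1 h2];
  apply/metallicP.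
- exact: (@Spec_w n j i).
- exact: Spec_yr.
- exact: Spec_y.
- exact: Spec_gr.
- exact: Spec_g.
- exact: Spec_br.
- exact: Spec_b.
- exact: (@Spec_j n r s k l).
Qed.

Lemma frac_subV (x : R) : 0 <= x < 1 ->
  frac (x - u) = if x < u then x - u + 1 else x - u.
Proof.
move=> /andP[x0 x1]; have u0 := betaV_gt0 R n_gt0; have u1 := betaV_lt1 R n_gt0.
case: ltP => h; last by rewrite frac_id //; apply/andP; split; lra.
have := frac_shift (x - u + 1) 1; rewrite addrK => ->.
by rewrite frac_id //; apply/andP; split; lra.
Qed.

(** As [u * (x + beta * y) = u * x + y], the second component of [Lambda n x y] and the third of
    [Lambda n y x] jump across parallel lines. *)
Lemma slope_cmp (c x y : R) : (u * c <= u * x + y) = (c <= x + beta * y).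
Proof.
have u0 := betaV_gt0 R n_gt0; have bu := beta_mulV R n_gt0.
rewrite -(ler_pM2l u0 c); congr (_ <= _).
by rewrite mulrDr mulrA [u * beta]mulrC bu mul1r.
Qed.

Lemma beta_facts :
  [/\ 0 < u, u < 1, 1 < beta, beta * u = 1 & u * u = 1 - n%:R * u].
Proof.
by split; [exact: betaV_gt0|exact: betaV_lt1|exact: beta_gt1|
  exact: beta_mulV|exact: betaV_sqr].
Qed.

Lemma Tile_w (x y : R) : 0 <= x < 1 -> 0 <= y < 1 -> u <= x -> u <= y ->
  mk_tile (Lambda n x y) (Lambda n y x) (Lambda n (x - u) y) (Lambda n (y - u) x)
    \in metallic_tiles n.
Proof.
move=> /andP[x0 x1] /andP[y0 y1] xu yu.
have [u0 u1 b1 bu uu] := beta_facts; have bE := betaE R n_gt0.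
have b0 : 0 < beta by lra.
have uu0 : 0 < u * u by rewrite mulr_gt0.
have bx : 1 <= beta * x by rewrite -bu ler_pM2l //; lra.
have by_ : 1 <= beta * y by rewrite -bu ler_pM2l //; lra.
have bx' : beta * x < beta by rewrite gtr_pMr //; lra.
have by_' : beta * y < beta by rewrite gtr_pMr //; lra.
have ux : u * u <= u * x by rewrite ler_pM2l.
have uy : u * u <= u * y by rewrite ler_pM2l.
have ux' : u * x < u by rewrite gtr_pMr.
have uy' : u * y < u by rewrite gtr_pMr.
(* [i] and [j] are the third components of the left and bottom labels. *)
have [|i /andP[i1 i2]] := @nonneg_floor (beta * x + y - u); first lra.
have [|j /andP[j1 j2]] := @nonneg_floor (beta * y + x - u); first lra.
have hi : (0 < i <= n)%N.
  have h1 : 0 < i.+1%:R - 1 :> R by rewrite -natr1; lra.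
  have h2 : i%:R < n.+1%:R :> R by rewrite -natr1; lra.
  by rewrite ltr_nat ltnS in h2; rewrite h2 andbT; move: h1; rewrite -natr1 addrK ltr0n.
have hj : (0 < j <= n)%N.
  have h1 : 0 < j.+1%:R - 1 :> R by rewrite -natr1; lra.
  have h2 : j%:R < n.+1%:R :> R by rewrite -natr1; lra.
  by rewrite ltr_nat ltnS in h2; rewrite h2 andbT; move: h1; rewrite -natr1 addrK ltr0n.
apply/metallicP.
rewrite (@Lambda_lab x y 1 1 i.+1) ?(@Lambda_lab y x 1 1 j.+1)
  ?(@Lambda_lab (x - u) y 1 1 i) ?(@Lambda_lab (y - u) x 1 1 j).
  exact: (Spec_w hi hj).
all: rewrite -?natr1; apply/andP; split; lra.
Qed.

(** The lines [x + beta * y = 1] and [x + beta * y = 1 + u] cut this strip into the regions of the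
    tiles [b], [g] and [y]. *)
Lemma Tile_horizontal (x y : R) : 0 <= x < 1 -> 0 <= y < 1 -> u <= x -> y < u ->
  mk_tile (Lambda n x y) (Lambda n y x) (Lambda n (x - u) y)
    (Lambda n (y - u + 1) x) \in metallic_tiles n.
Proof.
move=> /andP[x0 x1] /andP[y0 y1] xu yu.
have [u0 u1 b1 bu uu] := beta_facts; have bE := betaE R n_gt0.
have b0 : 0 < beta by lra.
have uu0 : 0 < u * u by rewrite mulr_gt0.
have bx : 1 <= beta * x by rewrite -bu ler_pM2l //; lra.
have bxE : beta * x = n%:R * x + u * x by rewrite {1}bE mulrDl.
have by_ : beta * y < 1 by rewrite -bu ltr_pM2l //; lra.
have by0 : 0 <= beta * y by rewrite mulr_ge0 //; lra.
have n0 : 0 < n%:R :> R by rewrite ltr0n.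
have nx : n%:R * x < n%:R by rewrite gtr_pMr.
have nx' : n%:R * u <= n%:R * x by rewrite ler_pM2l.
have ux : u * u <= u * x by rewrite ler_pM2l.
have ux' : u * x < u by rewrite gtr_pMr.
have uy : u * y < u * u by rewrite ltr_pM2l.
have uy0 : 0 <= u * y by rewrite mulr_ge0 // ltW.
have c1 := slope_cmp 1 x y; have c2 := slope_cmp (1 + u) x y.
have [|i /andP[i1 i2]] := @nonneg_floor (beta * x + y - u); first lra.
rewrite mulrDr mulr1 in c2; rewrite mulr1 in c1.
have iR (k : nat) : i%:R < k%:R :> R -> (i < k)%N by rewrite ltr_nat.
apply/metallicP.
have [h1|h1] := leP 1 (x + beta * y); last first.
{ have g1 : u * x + y < u by rewrite ltNge c1 -ltNge.
  rewrite (@Lambda_lab x y 0 0 i.+1) ?(@Lambda_lab y x 1 1 1)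
    ?(@Lambda_lab (x - u) y 0 0 i) ?(@Lambda_lab (y - u + 1) x 1 1 n).
    by apply: Spec_b; apply: iR; lra.
  all: rewrite -?natr1; apply/andP; split; lra. }
have g1 : u <= u * x + y by rewrite c1.
have [h2|h2] := leP (1 + u) (x + beta * y); last first.
{ have g2 : u * x + y < u + u * u by rewrite ltNge c2 -ltNge.
  rewrite (@Lambda_lab x y 0 1 i.+1) ?(@Lambda_lab y x 1 1 1)
    ?(@Lambda_lab (x - u) y 0 0 i) ?(@Lambda_lab (y - u + 1) x 1 1 n.+1).
    by apply: Spec_g; rewrite -ltnS; apply: iR; rewrite -natr1; lra.
  all: rewrite -?natr1; apply/andP; split; lra. }
have g2 : u + u * u <= u * x + y by rewrite c2.
rewrite (@Lambda_lab x y 0 1 i.+1) ?(@Lambda_lab y x 1 1 2)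
  ?(@Lambda_lab (x - u) y 0 1 i) ?(@Lambda_lab (y - u + 1) x 1 1 n.+1).
  apply: Spec_y; apply/andP; split; first by rewrite -(ltr_nat R); lra.
  by rewrite -ltnS; apply: iR; rewrite -natr1; lra.
all: rewrite -?natr1; apply/andP; split; lra.
Qed.

Lemma Tile_junction (x y : R) : 0 <= x < 1 -> 0 <= y < 1 -> x < u -> y < u ->
  mk_tile (Lambda n x y) (Lambda n y x) (Lambda n (x - u + 1) y)
    (Lambda n (y - u + 1) x) \in metallic_tiles n.
Proof.
move=> /andP[x0 x1] /andP[y0 y1] xu yu.
have [u0 u1 b1 bu uu] := beta_facts; have bE := betaE R n_gt0.
have b0 : 0 < beta by lra.
have uu0 : 0 < u * u by rewrite mulr_gt0.
have bx : beta * x < 1 by rewrite -bu ltr_pM2l //; lra.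
have by_ : beta * y < 1 by rewrite -bu ltr_pM2l //; lra.
have bx0 : 0 <= beta * x by rewrite mulr_ge0 //; lra.
have by0 : 0 <= beta * y by rewrite mulr_ge0 //; lra.
have ux : u * x < u * u by rewrite ltr_pM2l.
have uy : u * y < u * u by rewrite ltr_pM2l.
have ux0 : 0 <= u * x by rewrite mulr_ge0 // ltW.
have uy0 : 0 <= u * y by rewrite mulr_ge0 // ltW.
have uxx : u * x <= beta * x by rewrite ler_wpM2r //; lra.
have uyy : u * y <= beta * y by rewrite ler_wpM2r //; lra.
have u2 : u * u < u by rewrite gtr_pMr.
have c1 := slope_cmp 1 x y; have c2 := slope_cmp u x y.
have d1 := slope_cmp 1 y x; have d2 := slope_cmp u y x.
rewrite mulr1 in c1; rewrite mulr1 in d1.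
(* The last two components of the right and top labels; on this square each is the indicator of a
   half-plane. *)
pose k : nat := (1 <= x + beta * y)%R.
pose l : nat := (u <= beta * x + y)%R.
pose r : nat := (1 <= y + beta * x)%R.
pose s : nat := (u <= x + beta * y)%R.
have kb : if (1 <= x + beta * y) then k = 1%N /\ u <= u * x + y
          else k = 0%N /\ u * x + y < u.
  by case: ifP c1 => h c1; split; rewrite ?ltNge ?c1 // /k h.
have rb : if (1 <= y + beta * x) then r = 1%N /\ u <= u * y + x
          else r = 0%N /\ u * y + x < u.
  by case: ifP d1 => h d1; split; rewrite ?ltNge ?d1 // /r h.
have sb : if (u <= x + beta * y) then s = 1%N /\ u * u <= u * x + y
          else s = 0%N /\ u * x + y < u * u.
  by case: ifP c2 => h c2; split; rewrite ?ltNge ?c2 // /s h.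
have lb : if (u <= y + beta * x) then l = 1%N /\ u * u <= u * y + x
          else l = 0%N /\ u * y + x < u * u.
  by case: ifP d2 => h d2; split; rewrite ?ltNge ?d2 // /l addrC h.
clearbody k l r s.
have L1 : Lambda n x y = lab 0 k l.
  apply: Lambda_lab; first by lra.
    by clear lb; case: ifP kb => _ [-> kk]; lra.
  by clear kb; case: (leP u (y + beta * x)) lb => h [-> ll]; lra.
have L2 : Lambda n y x = lab 0 r s.
  apply: Lambda_lab; first by lra.
    by clear sb; case: ifP rb => _ [-> rr]; lra.
  by clear rb; case: (leP u (x + beta * y)) sb => h [-> ss]; lra.
have L3 : Lambda n (x - u + 1) y = lab 0 s (r + n).
  apply: Lambda_lab; first by lra.
    by clear rb; case: ifP sb => _ [-> ss]; lra.
  by clear sb; rewrite natrD; case: (leP 1 (y + beta * x)) rb => h [-> rr]; lra.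
have L4 : Lambda n (y - u + 1) x = lab 0 l (k + n).
  apply: Lambda_lab; first by lra.
    by clear kb; case: ifP lb => _ [-> ll]; lra.
  by clear lb; rewrite natrD; case: (leP 1 (x + beta * y)) kb => h [-> kk]; lra.
rewrite L1 L2 L3 L4; apply/metallicP; apply: Spec_j.
- case: (leP 1 (x + beta * y)) kb => hk [-> _];
    case: (leP u (y + beta * x)) lb => hl [-> _] //; lra.
- case: (leP 1 (y + beta * x)) rb => hr [-> _];
    case: (leP u (x + beta * y)) sb => hs [-> _] //; lra.
- case: (leP u (y + beta * x)) lb => hl [-> _];
    case: (leP 1 (y + beta * x)) rb => hr [-> _] //; lra.
- case: (leP u (x + beta * y)) sb => hs [-> _];
    case: (leP 1 (x + beta * y)) kb => hk [-> _] //; lra.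
Qed.

Lemma Tile_metallic (p : R * R) : Tile n p \in metallic_tiles n.
Proof.
have main (x y : R) : 0 <= x < 1 -> 0 <= y < 1 -> Tile n (x, y) \in metallic_tiles n.
  move=> hx hy; have [x0 x1] := andP hx; have [y0 y1] := andP hy.
  have TE : Tile n (x, y) = mk_tile (Lambda n x y) (Lambda n y x)
      (Lambda n (if x < u then x - u + 1 else x - u) y)
      (Lambda n (if y < u then y - u + 1 else y - u) x).
    by rewrite /Tile (frac_id hx) (frac_id hy) (frac_subV hx) (frac_subV hy).
  have TE' : Tile n (y, x) = mk_tile (Lambda n y x) (Lambda n x y)
      (Lambda n (if y < u then y - u + 1 else y - u) x)
      (Lambda n (if x < u then x - u + 1 else x - u) y).
    by rewrite /Tile (frac_id hx) (frac_id hy) (frac_subV hx) (frac_subV hy).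
  have [xu|xu] := ltP x u; have [yu|yu] := ltP y u.
  - rewrite TE xu yu; exact: Tile_junction.
  - rewrite Tile_reflect; apply: metallic_reflect.
    rewrite TE' xu ltNge yu /=; exact: Tile_horizontal.
  - rewrite TE yu ltNge xu /=; exact: Tile_horizontal.
  - rewrite TE !ltNge xu yu /=; exact: Tile_w.
case: p => x y.
rewrite (@Tile_congr R n (x, y) (frac x, frac y)) ?main ?frac_itv //.
by rewrite /congrZ2 /frac /= !opprB !addrA [x + _]addrC [y + _]addrC !addrK !intr_int.
Qed.

End TileValues.

(** * Reading tiles off the staircases *)

Section Coding.
Variables (R : realType) (n : nat).
Hypothesis n_gt0 : (0 < n)%N.
Local Notation beta := (beta R n).
Local Notation u := (beta^-1).

Definition strict_at (f : int -> int) (x : R) (p : int) : Prop :=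
  (f p)%:~R < x + p%:~R * u < (f p)%:~R + 1.

Definition floor_at (f : int -> int) (x : R) (p : int) : Prop :=
  (f p)%:~R <= x + p%:~R * u < (f p)%:~R + 1.

Lemma strict_floor_at f x p : strict_at f x p -> floor_at f x p.
Proof. by move=> /andP[h1 h2]; apply/andP; split; rewrite // ltW. Qed.

(** Since [beta = n + u], rotating by [beta * p] is rotating by [p u] modulo 1, and the fractional
    part is the offset. *)
Lemma frac_translate (f : int -> int) (x : R) (p : int) : floor_at f x p ->
  frac (x + beta * p%:~R) = x + p%:~R * u - (f p)%:~R.
Proof.
move=> /andP[h1 h2]; have bE := betaE R n_gt0.
have -> : x + beta * p%:~R = x + p%:~R * u - (f p)%:~R - (- (n%:Z * p + f p))%:~R.
  by rewrite {1}bE rmorphN rmorphD rmorphM /=; ring.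
by rewrite frac_shift frac_id //; apply/andP; split; lra.
Qed.

Lemma frac_translate_pred (f : int -> int) (x : R) (p : int) :
  floor_at f x (p - 1) ->
  frac (x + beta * p%:~R - u) = x + (p - 1)%:~R * u - (f (p - 1))%:~R.
Proof.
move=> h; rewrite -(frac_translate h) -(frac_shift (x + beta * p%:~R - u) n%:Z).
congr frac; have bE := betaE R n_gt0.
have -> : n%:Z%:~R = n%:R :> R by [].
by rewrite rmorphB /= mulrBr mulr1; lra.
Qed.

(** From [beta * (p u) = p] and [beta = n + u], the third floor falls on the line of [beta * x + y]
    at index [q - f p - 1]: points of the plane obey the formulas of [staircases]. *)
Lemma Lambda_translate (f g h : int -> int) (x y : R) (p q : int) :
  floor_at f x p -> floor_at g y q -> floor_at g y (q - 1) ->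
  floor_at h (beta * x + y) (q - f p - 1) ->
  let l := Lambda n (x + p%:~R * u - (f p)%:~R) (y + q%:~R * u - (g q)%:~R) in
  lab0 l = g (q - 1) - g q + 1 /\
  lab2 l = h (q - f p - 1) - n%:Z * f p + p - g q + 1.
Proof.
move=> /andP[f1 f2] /andP[g1 g2] /andP[k1 k2] /andP[h1 h2] /=.
have bE := betaE R n_gt0; have bu := beta_mulV R n_gt0.
move: k1 k2 h1 h2; rewrite !rmorphB /= => k1 k2 h1 h2.
have e1 : beta * (p%:~R * u) = p%:~R by rewrite mulrCA bu mulr1.
have e2 : beta * (f p)%:~R = n%:R * (f p)%:~R + u * (f p)%:~R.
  by rewrite {1}bE mulrDl.
split; apply: floor_unique; rewrite !(rmorphD, rmorphB, rmorphM) /=; lra.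
Qed.

Variables (X Y V W : int -> int).

(* The points whose tiles at [k] and at its left and lower neighbours are read off
   the staircases with no line of the partition crossed or touched. *)
Definition cell (k : Z2) : set (R * R) := [set t |
  [/\ strict_at X t.1 k.1, strict_at X t.1 (k.1 - 1),
      strict_at Y t.2 k.2 & strict_at Y t.2 (k.2 - 1)] /\
  [/\ strict_at V (beta * t.1 + t.2) (k.2 - X k.1 - 1),
      strict_at V (beta * t.1 + t.2) (k.2 - X (k.1 - 1) - 1),
      strict_at W (beta * t.2 + t.1) (k.1 - Y k.2 - 1) &
      strict_at W (beta * t.2 + t.1) (k.1 - Y (k.2 - 1) - 1)]].

(** The floors give the first and third components, which determine a metallic tile. *)
Lemma Tile_cell (A B : int -> int -> label) (k : Z2) (t : tile label) (p : R * R) :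
  staircases n A B X Y V W -> cell k p -> t \in metallic_tiles n ->
  right t = A k.1 k.2 -> top t = B k.1 k.2 ->
  left t = A (k.1 - 1) k.2 -> bottom t = B k.1 (k.2 - 1) ->
  Tile n (translate n k p) = t.
Proof.
case: k p => k1 k2 [x y] st [[/=]].
move=> /strict_floor_at x1 /strict_floor_at x2.
move=> /strict_floor_at y1 /strict_floor_at y2.
move=> [/= /strict_floor_at v1 /strict_floor_at v2].
move=> /strict_floor_at w1 /strict_floor_at w2.
move=> ht rt tt lt bt.
have [r0 r2] := Lambda_translate x1 y1 y2 v1.
have [t0 t2] := Lambda_translate y1 x1 x2 w1.
have [l0 l2] := Lambda_translate x2 y1 y2 v2.
have [b0 b2] := Lambda_translate y2 x1 x2 w2.
rewrite -(frac_translate x1) -(frac_translate y1) in r0 r2.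
rewrite -(frac_translate x1) -(frac_translate y1) in t0 t2.
rewrite -(frac_translate_pred x2) -(frac_translate y1) in l2.
rewrite -(frac_translate_pred y2) -(frac_translate x1) in b2.
have hT := Tile_metallic n_gt0 (translate n (k1, k2) (x, y)).
apply: (metallic_tile_eq hT ht).
- by rewrite rt; have := stairY st k1 k2; move: r0; rewrite /Tile /right /=; lia.
- by rewrite tt; have := stairX st k1 k2; move: t0; rewrite /Tile /top /=; lia.
- by rewrite rt (stairV st); exact: r2.
- by rewrite tt (stairW st); exact: t2.
- by rewrite lt (stairV st); exact: l2.
- by rewrite bt (stairW st); exact: b2.
Qed.

Lemma cell_near (x y v1 v2 : R) :
  intercept n X x -> intercept n Y y ->
  intercept n V (beta * x + y) -> intercept n W (beta * y + x) ->
  inward n X x v1 -> inward n Y y v2 ->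
  inward n V (beta * x + y) (beta * v1 + v2) ->
  inward n W (beta * y + x) (beta * v2 + v1) ->
  forall ks : seq Z2, \forall e \near 0^'+, forall k : Z2, k \in ks ->
    cell k (x + e * v1, y + e * v2).
Proof.
move=> hx hy hz hw ix iy iz iw; elim=> [|[k1 k2] ks IH]; first by near=> e.
have nx := inward_strict hx ix [:: k1; k1 - 1].
have ny := inward_strict hy iy [:: k2; k2 - 1].
have nz := inward_strict hz iz [:: k2 - X k1 - 1; k2 - X (k1 - 1) - 1].
have nw := inward_strict hw iw [:: k1 - Y k2 - 1; k1 - Y (k2 - 1) - 1].
near=> e => k; rewrite inE => /orP[/eqP ->|]; last first.
  by move: k; near: e.
have zE : beta * (x + e * v1) + (y + e * v2) = beta * x + y + e * (beta * v1 + v2).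
  by ring.
have wE : beta * (y + e * v2) + (x + e * v1) = beta * y + x + e * (beta * v2 + v1).
  by ring.
have ex : forall p : int, p \in [:: k1; k1 - 1] -> strict_at X (x + e * v1) p.
  by near: e.
have ey : forall p : int, p \in [:: k2; k2 - 1] -> strict_at Y (y + e * v2) p.
  by near: e.
have ez : forall p : int, p \in [:: k2 - X k1 - 1; k2 - X (k1 - 1) - 1] ->
    strict_at V (beta * x + y + e * (beta * v1 + v2)) p.
  by near: e.
have ew : forall p : int, p \in [:: k1 - Y k2 - 1; k1 - Y (k2 - 1) - 1] ->
    strict_at W (beta * y + x + e * (beta * v2 + v1)) p.
  by near: e.
split; split=> /=; rewrite ?zE ?wE.
all: by [apply: ex; rewrite !inE eqxx ?orbT|apply: ey; rewrite !inE eqxx ?orbT|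
  apply: ez; rewrite !inE eqxx ?orbT|apply: ew; rewrite !inE eqxx ?orbT].
Unshelve. all: by end_near. Qed.

Lemma open_strict_at (f : int -> int) (p : int) (g : R * R -> R) :
  continuous g -> open [set t | strict_at f (g t) p].
Proof.
move=> gc; rewrite (_ : [set t | _] =
  (g @^-1` [set z | (f p)%:~R - p%:~R * u < z])
  `&` (g @^-1` [set z | z < (f p)%:~R + 1 - p%:~R * u])).
  by apply: openI; (apply: open_comp => [t _|]; first exact: gc);
    [exact: open_gt|exact: open_lt].
apply/seteqP; split=> t /=; rewrite /strict_at; first by move=> /andP[]; lra.
by case=> h1 h2; apply/andP; split; lra.
Qed.

Lemma open_cell (k : Z2) : open (cell k).
Proof.
have c1 : continuous (fun t : R * R => t.1) by move=> t; exact: cvg_fst.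
have c2 : continuous (fun t : R * R => t.2) by move=> t; exact: cvg_snd.
have cz : continuous (fun t : R * R => beta * t.1 + t.2).
  by move=> t; apply: cvgD; [apply: cvgM; [exact: cvg_cst|exact: c1]|exact: c2].
have cw : continuous (fun t : R * R => beta * t.2 + t.1).
  by move=> t; apply: cvgD; [apply: cvgM; [exact: cvg_cst|exact: c2]|exact: c1].
rewrite (_ : cell k =
  ([set t : R * R | strict_at X t.1 k.1] `&` [set t | strict_at X t.1 (k.1 - 1)] `&`
   [set t | strict_at Y t.2 k.2] `&` [set t | strict_at Y t.2 (k.2 - 1)]) `&`
  ([set t | strict_at V (beta * t.1 + t.2) (k.2 - X k.1 - 1)] `&`
   [set t | strict_at V (beta * t.1 + t.2) (k.2 - X (k.1 - 1) - 1)] `&`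
   [set t | strict_at W (beta * t.2 + t.1) (k.1 - Y k.2 - 1)] `&`
   [set t | strict_at W (beta * t.2 + t.1) (k.1 - Y (k.2 - 1) - 1)])).
  by do ![apply: openI]; apply: open_strict_at.
apply/seteqP; split=> t /=.
  by case=> -[? ? ? ?] [? ? ? ?]; do !split.
by case=> -[[[? ?] ?] ?] [[[? ?] ?] ?]; split; split.
Qed.

End Coding.

(** * Topology of the torus *)

Section Action.
Variables (T : Type) (f : Z2action T).

Lemma act_image (k : Z2) (P : set T) (x : T) : (f (- k) @` P) x <-> P (f k x).
Proof.
split=> [[y Py <-]|Px]; first by rewrite -actD subrr act0.
by exists (f k x) => //; rewrite -actD addNr act0.
Qed.

End Action.

Section TorusTopology.
Variable R : realType.

Lemma torus_pi_continuous : continuous (@torus_pi R).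
Proof. exact: pi_continuous. Qed.

Lemma translation_continuous (c : R * R) :
  continuous (fun p : R * R => (p.1 + c.1, p.2 + c.2)).
Proof.
move=> p.
have h1 : q.1 + c.1 @[q --> p] --> p.1 + c.1.
  by apply: cvgD; [exact: cvg_fst|exact: cvg_cst].
have h2 : q.2 + c.2 @[q --> p] --> p.2 + c.2.
  by apply: cvgD; [exact: cvg_snd|exact: cvg_cst].
exact: cvg_pair h1 h2.
Qed.

(** The saturation of [U] is the union of its integer translates. *)
Lemma torus_pi_open (U : set (R * R)) : open U -> open (@torus_pi R @` U).
Proof.
move=> Uo.
have : open (@torus_pi R @^-1` (@torus_pi R @` U)); last by [].
rewrite (_ : _ @^-1` _ = \bigcup_(k in [set: Z2])
    ((fun p : R * R => (p.1 + k.1%:~R, p.2 + k.2%:~R)) @^-1` U)).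
  apply: bigcup_open => k _; apply: open_comp => // p _.
  exact: (@translation_continuous (k.1%:~R, k.2%:~R)).
apply/seteqP; split=> p /=.
- case=> q Uq /torus_piP/andP[/intrP[i hi] /intrP[j hj]]; exists (i, j) => //=.
  by rewrite -hi -hj !addrA [p.1 + _]addrC [p.2 + _]addrC !addrK; case: q Uq {hi hj}.
- case=> k _ Uk; exists (p.1 + k.1%:~R, p.2 + k.2%:~R) => //.
  apply/torus_piP; rewrite /congrZ2 /= [p.1 + _]addrC [p.2 + _]addrC !addrK.
  by rewrite !intr_int.
Qed.

Variable n : nat.

Lemma partition_Tile (t : metallic_tiles n) (p : R * R) :
  metallic_partition R n t (torus_pi p) -> Tile n p = val t.
Proof. by move=> /interior_subset /=; rewrite torus_Tile_pi. Qed.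

Lemma rotation_partition_Tile (t : metallic_tiles n) (k : Z2) (p : R * R) :
  metallic_partition R n t (rotation R n k (torus_pi p)) ->
  Tile n (translate n k p) = val t.
Proof. by rewrite /= rotation_fun_pi; exact: partition_Tile. Qed.

Lemma rotation_partition (t : metallic_tiles n) (k : Z2) (U : set (R * R)) (p : R * R) :
  open U -> (forall q, U q -> Tile n (translate n k q) = val t) -> U p ->
  metallic_partition R n t (rotation R n k (torus_pi p)).
Proof.
move=> Uo Ut Up; rewrite /= rotation_fun_pi.
pose c : R * R := (- (beta R n * k.1%:~R), - (beta R n * k.2%:~R)).
pose U' := (fun q : R * R => (q.1 + c.1, q.2 + c.2)) @^-1` U.
have U'o : open U' by apply: open_comp => // q _; exact: translation_continuous.
have U'E q : U' (translate n k q) <-> U q.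
  by rewrite /U' /= /translate /c /= !addrK; case: q.
rewrite /metallic_partition /interior /=.
have : nbhs (torus_pi (translate n k p)) (@torus_pi R @` U').
  apply: open_nbhs_nbhs; split; first exact: torus_pi_open.
  by exists (translate n k p) => //; exact/U'E.
apply: filterS => _ [q U'q <-] /=; rewrite torus_Tile_pi.
have qE : q = translate n k (q.1 + c.1, q.2 + c.2).
  by rewrite /translate /c /= !subrK; case: q {U'q}.
by rewrite qE; exact: Ut.
Qed.

End TorusTopology.

(** * Staircases of a point of the plane *)

Section PointStaircases.
Variables (R : realType) (n : nat).
Hypothesis n_gt0 : (0 < n)%N.
Local Notation beta := (beta R n).
Local Notation u := (beta^-1).

Definition line (x : R) (p : int) : int := Num.floor (x + p%:~R * u).

Lemma line_floor_at (x : R) (p : int) : floor_at n (line x) x p.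
Proof. by rewrite /floor_at /line; have := floor_itv (x + p%:~R * u); rewrite intrD. Qed.

Lemma line_intercept (x : R) : intercept n (line x) x.
Proof. by move=> p; have /andP[h1 h2] := line_floor_at x p; rewrite h1 ltW. Qed.

Lemma line_inward (x v : R) : 0 < v -> inward n (line x) x v.
Proof.
move=> v0; split=> // -[p e]; have /andP[_] := line_floor_at x p.
by rewrite e ltxx.
Qed.

Definition point_right (x y : R) (p q : int) : label :=
  right (Tile n (translate n (p, q) (x, y))).
Definition point_top (x y : R) (p q : int) : label :=
  top (Tile n (translate n (p, q) (x, y))).

Lemma point_rightE (x y : R) (p q : int) :
  point_right x y p q =
  Lambda n (x + p%:~R * u - (line x p)%:~R) (y + q%:~R * u - (line y q)%:~R).
Proof.
rewrite /point_right /Tile /translate /right /=.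
by rewrite (frac_translate n_gt0 (line_floor_at x p))
  (frac_translate n_gt0 (line_floor_at y q)).
Qed.

Lemma point_topE (x y : R) (p q : int) : point_top x y p q = point_right y x q p.
Proof. by []. Qed.

Lemma point_leftE (x y : R) (p q : int) :
  left (Tile n (translate n (p, q) (x, y))) = point_right x y (p - 1) q.
Proof.
rewrite point_rightE /Tile /translate /left /=.
by rewrite (frac_translate_pred n_gt0 (line_floor_at x (p - 1)))
  (frac_translate n_gt0 (line_floor_at y q)).
Qed.

Lemma point_bottomE (x y : R) (p q : int) :
  bottom (Tile n (translate n (p, q) (x, y))) = point_top x y p (q - 1).
Proof. by rewrite point_topE -point_leftE. Qed.

Lemma point_staircases (x y : R) : 0 <= x < 1 -> 0 <= y < 1 ->
  staircases n (point_right x y) (point_top x y) (line x) (line y)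
    (line (beta * x + y)) (line (beta * y + x)).
Proof.
move=> /andP[x0 x1] /andP[y0 y1].
have fx := line_floor_at x; have fy := line_floor_at y.
have fz := line_floor_at (beta * x + y); have fw := line_floor_at (beta * y + x).
split; rewrite /line ?mul0r ?addr0.
- by apply: floor_unique; rewrite ?add0r.
- by apply: floor_unique; rewrite ?add0r.
all: rewrite -/(line _ _) => p q; rewrite ?point_topE point_rightE.
- have [-> _] := Lambda_translate n_gt0 (fy q) (fx p) (fx (p - 1))
    (fw (p - line y q - 1)).
  by rewrite -/(line x p) -/(line x (p - 1)); lia.
- have [-> _] := Lambda_translate n_gt0 (fx p) (fy q) (fy (q - 1))
    (fz (q - line x p - 1)).
  by rewrite -/(line y q) -/(line y (q - 1)); lia.
- by have [_ ->] := Lambda_translate n_gt0 (fx p) (fy q) (fy (q - 1))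
    (fz (q - line x p - 1)).
- by have [_ ->] := Lambda_translate n_gt0 (fy q) (fx p) (fx (p - 1))
    (fw (p - line y q - 1)).
Qed.

(** Serves representatives anywhere in the plane, where [line x 0] may differ from 0. *)
Lemma point_increment (x y : R) (p q : int) :
  line x p - line x (p - 1) = 1 - lab0 (point_top x y p q) /\
  line y q - line y (q - 1) = 1 - lab0 (point_right x y p q).
Proof.
have fx := line_floor_at x; have fy := line_floor_at y.
rewrite point_topE !point_rightE; split.
  have [-> _] := Lambda_translate n_gt0 (fy q) (fx p) (fx (p - 1))
    (line_floor_at _ (p - line y q - 1)).
  lia.
have [-> _] := Lambda_translate n_gt0 (fx p) (fy q) (fy (q - 1))
  (line_floor_at _ (q - line x p - 1)).
lia.
Qed.

(** An index with offset below [e] bounds [a] from below, one with offset above [1 - e] bounds it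
    from above; density of the offsets provides both. *)
Lemma intercept_narrow (f : int -> int) (x e : R) : intercept n f x -> 0 < e ->
  exists N : nat, forall a : R,
    (forall p : int, (`|p| <= N)%N -> (f p)%:~R <= a + p%:~R * u <= (f p)%:~R + 1) ->
    `|a - x| < e.
Proof.
move=> fx e0.
have d0 : 0 < Num.min e 1 by rewrite lt_min e0 ltr01.
have d1 : Num.min e 1 <= 1 by rewrite ge_min lexx orbT.
have de : Num.min e 1 <= e by rewrite ge_min lexx.
have [p /andP[p0 pe]] := intercept_dense n_gt0 fx (lexx 0) d0 d1.
have [|||q /andP[qe q1]] := @intercept_dense R n n_gt0 f x (1 - Num.min e 1) 1 fx.
- by rewrite subr_ge0.
- by rewrite ltrBlDr ltrDl.
- by [].
exists (maxn `|p| `|q|) => a ha.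
have /andP[h1 _] := ha p (leq_maxl _ _); have /andP[_ h2] := ha q (leq_maxr _ _).
by rewrite ltr_norml; apply/andP; split; lra.
Qed.

End PointStaircases.

(** * The Wang shift as a symbolic system *)

Section WangFiniteType.
Variables (L : choiceType) (S : {fset tile L}).

Definition domino (h : Z2) (a b : S) : pattern S :=
  [fmap k : [fset 0; h]%fset => if val k == 0 then a else b].

Lemma restriction_domino (w : config S) (m h : Z2) : h != 0 ->
  restriction (shift m w) [fset 0; h]%fset = domino h (w m) (w (m + h)).
Proof.
move=> h0; congr FinMap; apply/ffunP => k; rewrite !ffunE /shift.
have : val k \in [fset 0; h]%fset by exact: valP.
rewrite in_fset2 => /orP[]/eqP ->; first by rewrite eqxx add0r.
by rewrite (negPf h0) addrC.
Qed.

Lemma domino_inj (h : Z2) (a b a' b' : S) : h != 0 ->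
  domino h a b = domino h a' b' -> a = a' /\ b = b'.
Proof.
move=> h0 e.
have e0 : (domino h a b).[? 0]%fmap = (domino h a' b').[? 0]%fmap by rewrite e.
have eh : (domino h a b).[? h]%fmap = (domino h a' b').[? h]%fmap by rewrite e.
have h00 : 0 \in [fset 0; h]%fset by exact: fset21.
have hh : h \in [fset 0; h]%fset by exact: fset22.
move: e0 eh; rewrite !in_fnd !ffunE /= (negPf h0).
by move=> [->] [->].
Qed.

(** The forbidden patterns are the horizontal and vertical dominoes whose common edge carries two
    different labels. *)
Lemma wang_finite_type : shift_of_finite_type (wang_shift (S := S)).
Proof.
pose bad (h : Z2) (c : S -> S -> bool) : {fset pattern S} :=
  [fset domino h ab.1 ab.2 | ab in [seq ab <- enum {: S * S} | c ab.1 ab.2]]%fset.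
have badP (h : Z2) (c : S -> S -> bool) (p : pattern S) :
    reflect (exists a b : S, c a b /\ p = domino h a b) (p \in bad h c).
  apply: (iffP (imfsetP _ _ _ _)) => [[[a b] + ->]|[a [b [cab ->]]]].
    by rewrite /= mem_filter => /andP[cab _]; exists a, b.
  by exists (a, b) => //=; rewrite mem_filter cab mem_enum.
pose cR (a b : S) := right (val a) != left (val b).
pose cT (a b : S) := top (val a) != bottom (val b).
exists (bad (1, 0) cR `|` bad (0, 1) cT)%fset.
have e1 : ((1, 0) : Z2) != 0 by [].
have e2 : ((0, 1) : Z2) != 0 by [].
apply/seteqP; split=> w /= hw.
- move=> p; rewrite in_fsetU => /orP[]/badP[a [b [cab pE]]] [m];
    rewrite pE restriction_domino // => /domino_inj[//|aE bE]; move: cab;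
    rewrite -aE -bE.
  + by rewrite /cR (proj1 (hw m)) eqxx.
  + by rewrite /cT (proj2 (hw m)) eqxx.
- move=> m; split; apply/eqP/negPn/negP => c.
  + apply: (hw (domino (1, 0) (w m) (w (m + (1, 0))))).
      by rewrite in_fsetU; apply/orP; left; apply/badP; exists (w m), (w (m + (1, 0))).
    by exists m; rewrite restriction_domino.
  + apply: (hw (domino (0, 1) (w m) (w (m + (0, 1))))).
      by rewrite in_fsetU; apply/orP; right; apply/badP; exists (w m), (w (m + (0, 1))).
    by exists m; rewrite restriction_domino.
Qed.

End WangFiniteType.

(** * Equality of the two systems and symbolic representation *)

Section Main.
Variables (R : realType) (n : nat).
Hypothesis n_gt0 : (0 < n)%N.
Local Notation beta := (beta R n).
Local Notation u := (beta^-1).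
Local Notation P := (metallic_partition R n).
Local Notation rot := (rotation R n).

Definition config_right (w : config (metallic_tiles n)) (p q : int) : label :=
  right (val (w (p, q))).
Definition config_top (w : config (metallic_tiles n)) (p q : int) : label :=
  top (val (w (p, q))).

Lemma config_left w (p q : int) : metallic_wang_shift n w ->
  left (val (w (p, q))) = config_right w (p - 1) q.
Proof.
move=> hw; rewrite /config_right (proj1 (hw (p - 1, q))).
by congr (left (val (w _))); congr pair; rewrite /= ?subrK ?addr0.
Qed.

Lemma config_bottom w (p q : int) : metallic_wang_shift n w ->
  bottom (val (w (p, q))) = config_top w p (q - 1).
Proof.
move=> hw; rewrite /config_top (proj2 (hw (p, q - 1))).
by congr (bottom (val (w _))); congr pair; rewrite /= ?subrK ?addr0.
Qed.

Lemma config_rules w : metallic_wang_shift n w ->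
  labels_rules n (config_right w) (config_top w) /\
  labels_rules n (transp (config_top w)) (transp (config_right w)).
Proof.
move=> hw.
have tE (p q : int) : mk_tile (config_right w p q) (config_top w p q)
    (config_right w (p - 1) q) (config_top w p (q - 1)) = val (w (p, q)).
  rewrite -config_left // -config_bottom // /config_right /config_top.
  by case: (val (w (p, q))) => [[[? ?] ?] ?].
split=> p q.
  by rewrite tE; apply: metallic_column_rules; exact: valP.
have := metallic_reflect_column_rules (valP (w (q, p))).
by rewrite -tE.
Qed.

(** The point [(x, y)] may lie on boundaries of atoms; the ray from it in the direction [(v1, v2)]
    starts inside the open atoms prescribed on any finite set of indices. *)
Lemma config_coding w : metallic_wang_shift n w ->
  exists x y v1 v2 : R, exists X Y V W : int -> int,
    [/\ staircases n (config_right w) (config_top w) X Y V W,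
        intercept n X x, intercept n Y y &
        forall ks : seq Z2, \forall e \near 0^'+, forall k : Z2, k \in ks ->
          P (w k) (rot k (torus_pi (x + e * v1, y + e * v2)))].
Proof.
move=> hw; have [hA hB] := config_rules hw.
have [X [Y [V [W st]]]] := staircases_exist hA hB.
have st' := staircases_transp st.
have [y [z [hy hz]]] := staircase_intercepts R n_gt0 hA hB st.
have [x [t [hx ht]]] := staircase_intercepts R n_gt0 hB hA st'.
have zE := stair_intercept_third n_gt0 hA hB st hx hy hz.
have tE := stair_intercept_third n_gt0 hB hA st' hy hx ht.
rewrite zE in hz; rewrite tE in ht.
have [v1 [v2 [ix iy iz it]]] := inward_direction n_gt0 hA hB st hx hy hz ht.
exists x, y, v1, v2, X, Y, V, W; split=> // ks.
have cells := cell_near hx hy hz ht ix iy iz it ks.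
near=> e => k kks.
have ck : cell n X Y V W k (x + e * v1, y + e * v2) by move: k kks; near: e.
apply: (rotation_partition (@open_cell R n X Y V W k) _ ck) => q cq.
apply: (Tile_cell n_gt0 st cq (valP (w k))); case: k {kks ck cq} => k1 k2 //=.
- exact: config_left.
- exact: config_bottom.
Unshelve. all: by end_near. Qed.

Lemma shift_wang w (m : Z2) :
  metallic_wang_shift n w -> metallic_wang_shift n (shift m w).
Proof. by move=> hw k; rewrite /shift -!(addrAC k m); exact: hw. Qed.

Lemma wang_symbolic w : metallic_wang_shift n w -> symbolic_system P rot w.
Proof.
move=> hw m S.
have [x [y [v1 [v2 [X [Y [V [W [_ _ _ hcode]]]]]]]]] := config_coding (shift_wang m hw).
have [e he] := filter_ex (hcode (enum_fset S)).
exists (torus_pi (x + e * v1, y + e * v2)) => k _.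
apply/act_image; rewrite ffunE; apply: he; exact: valP.
Qed.

(** Allowed dominoes suffice: both tiles are read along the orbit of one point, where adjacent
    labels agree. *)
Lemma symbolic_wang w : symbolic_system P rot w -> metallic_wang_shift n w.
Proof.
move=> hw m.
have pairs (h : Z2) : exists p : R * R,
    Tile n (translate n 0 p) = val (w m) /\ Tile n (translate n h p) = val (w (m + h)).
  have [t] := hw m [fset 0; h]%fset; rewrite -[t]torus_reprK.
  move: (repr t) => p ht; exists p; split; apply: rotation_partition_Tile.
    have /act_image := ht [` fset21 0 h]%fset I.
    have -> : val [` fset21 0 h]%fset = 0 by [].
    by rewrite ffunE /shift add0r.
  have /act_image := ht [` fset22 0 h]%fset I.
  have -> : val [` fset22 0 h]%fset = h by [].
  by rewrite ffunE /shift addrC.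
split.
- have [[x y] [h0 h1]] := pairs (1, 0); rewrite -h0 -h1 point_leftE //.
- have [[x y] [h0 h1]] := pairs (0, 1); rewrite -h0 -h1 point_bottomE //.
Qed.

(* Every point is coded by staircases of floors, and floors are right-continuous:
   hence the direction [(1, 1)] is inward. *)
Lemma torus_partition : topological_partition P.
Proof.
split=> [t|s t st|].
- exact: open_interior.
- apply/seteqP; split=> // x [xs xt]; apply: st; apply/val_inj.
  by rewrite -(interior_subset xs) -(interior_subset xt).
- apply/seteqP; split=> // T0 _.
  pose x := frac (repr T0).1; pose y := frac (repr T0).2.
  have TE : T0 = torus_pi (x, y).
    rewrite -[LHS]torus_reprK; apply/torus_piP; rewrite /congrZ2 /x /y /frac /=.
    rewrite !opprB !addrA [(repr T0).1 + _]addrC [(repr T0).2 + _]addrC !addrK.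
    by rewrite !intr_int.
  have x01 := frac_itv (repr T0).1; have y01 := frac_itv (repr T0).2.
  have st := point_staircases n_gt0 x01 y01; rewrite -/x -/y in st.
  have b0 : 0 < beta by apply: lt_trans (beta_gt1 R n_gt0).
  have b1 : 0 < beta * 1 + 1 by rewrite mulr1 addr_gt0.
  have near1 := cell_near (line_intercept n x) (line_intercept n y)
    (line_intercept n _) (line_intercept n _) (line_inward n x ltr01)
    (line_inward n y ltr01) (line_inward n _ b1) (line_inward n _ b1) [:: 0].
  have hT := Tile_metallic n_gt0 (translate n 0 (x, y)).
  exists [` hT]%fset => //= B; rewrite TE => /torus_pi_continuous nB.
  have cv : (x + e * 1, y + e * 1) @[e --> (0:R)^'+] --> (x, y).
    exact: cvg_pair (@cvg_ray R x 1) (@cvg_ray R y 1).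
  have [e [ce Be]] := filter_ex (filterI near1 (cv _ nB)).
  have c0 := ce 0 (mem_head _ _).
  exists (torus_pi (x + e * 1, y + e * 1)); split => //.
  rewrite -[torus_pi _](act0 rot).
  apply: (rotation_partition (@open_cell R n _ _ _ _ 0) _ c0) => q cq.
  apply: (Tile_cell n_gt0 st cq hT) => //.
  + exact: point_leftE.
  + exact: point_bottomE.
Qed.

(** A positive fractional part [f] of [a - x] would keep it at distance at least the minimum of [f]
    and [1 - f] from every integer. *)
Lemma circle_eq (a x : R) :
  (forall e, 0 < e -> exists j : int, `|a - j%:~R - x| < e) -> a - x \is a Num.int.
Proof.
move=> h.
pose f := frac (a - x).
have /andP[f0 f1] : 0 <= f < 1 := frac_itv _.
have [f00|fn0] := eqVneq f 0.
  by move/eqP: f00; rewrite /f /frac subr_eq0 => /eqP ->; rewrite intr_int.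
have fp : 0 < f by rewrite lt_neqAle eq_sym fn0.
have [|j] := h (Num.min f (1 - f)); first by rewrite lt_min fp subr_gt0.
rewrite lt_min !ltr_norml => /andP[/andP[h1 h2] /andP[h3 h4]].
have fE : a - x = f + (Num.floor (a - x))%:~R by rewrite /f /frac subrK.
have : (0 < (Num.floor (a - x) - j + 1)%:~R :> R).
  by rewrite rmorphD rmorphB /=; lra.
have : ((Num.floor (a - x) - j)%:~R < 0 :> R).
  by rewrite rmorphB /=; lra.
by rewrite ltr0z ltrz0; lia.
Qed.

(** Points of a large cylinder near [(a, b)] carry the tiles of [w] along both axes, hence the
    increments of [X] and [Y], and these pin the points near [(x, y)] modulo integers. *)
Lemma cylinder_closure_eq w (x y a b : R) X Y V W :
  staircases n (config_right w) (config_top w) X Y V W ->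
  intercept n X x -> intercept n Y y ->
  (forall m, closure (cylinder P rot w m) (torus_pi (a, b))) ->
  a - x \is a Num.int /\ b - y \is a Num.int.
Proof.
move=> st hx hy hcl.
have approx (e : R) : 0 < e -> exists c d : R, exists j k : int,
    [/\ `|c - a| < e, `|d - b| < e, `|c - j%:~R - x| < e & `|d - k%:~R - y| < e].
  move=> e0.
  have [N1 hN1] := intercept_narrow n_gt0 hx e0.
  have [N2 hN2] := intercept_narrow n_gt0 hy e0.
  pose N := maxn N1 N2.
  pose U := [set q : R * R | `|q.1 - a| < e /\ `|q.2 - b| < e].
  have Uo : open U.
    have -> : U = [set q | `|q.1 - a| < e] `&` [set q | `|q.2 - b| < e] by [].
    have dist (g : R * R -> R) (z : R) : continuous g -> open [set q | `|g q - z| < e].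
      move=> gc; apply: (@open_comp _ _ (fun q => `|g q - z|) [set r | r < e]) => [q _|].
        by apply: cvg_norm; apply: cvgB; [exact: gc|exact: cvg_cst].
      exact: open_lt.
    by apply: openI; apply: dist => q; [exact: cvg_fst|exact: cvg_snd].
  have [t [cyl [[c d] [/= ca db] te]]] : cylinder P rot w N `&` (@torus_pi R @` U) !=set0.
    apply: hcl; apply: open_nbhs_nbhs; split; first exact: torus_pi_open.
    by exists (a, b) => //; split; rewrite /= subrr normr0.
  rewrite -te in cyl.
  have tile (k : Z2) : (norm1 k <= N)%N -> Tile n (translate n k (c, d)) = val (w k).
    move=> kN; apply: rotation_partition_Tile; exact/act_image/(cyl k kN).
  (* As [X 0 = 0] and [Y 0 = 0], the integer parts of [c] and [d] have to be removed. *)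
  exists c, d, (line n c 0), (line n d 0); split => //.
  - apply: hN1 => p pN.
    have inc (q : int) : (`|q| <= N1)%N ->
        line n c q - line n c (q - 1) = X q - X (q - 1).
      move=> qN; rewrite (proj1 (point_increment n_gt0 c d q 0)) (stairX st q 0).
      by rewrite /point_top tile // /norm1 /= addn0 (leq_trans qN) ?leq_maxl.
    have <- := increments_eq (stairX0 st) inc pN.
    have /andP[h1 h2] := line_floor_at n c p.
    by rewrite !rmorphB /=; apply/andP; split; lra.
  - apply: hN2 => p pN.
    have inc (q : int) : (`|q| <= N2)%N ->
        line n d q - line n d (q - 1) = Y q - Y (q - 1).
      move=> qN; rewrite (proj2 (point_increment n_gt0 c d 0 q)) (stairY st 0 q).
      by rewrite /point_right tile // /norm1 /= add0n (leq_trans qN) ?leq_maxr.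
    have <- := increments_eq (stairY0 st) inc pN.
    have /andP[h1 h2] := line_floor_at n d p.
    by rewrite !rmorphB /=; apply/andP; split; lra.
have half (e : R) : 0 < e -> 0 < e / 2 by move=> ?; rewrite divr_gt0.
split; apply: circle_eq => e /half/approx[c [d [j [k []]]]];
  rewrite !ltr_norml => /andP[? ?] /andP[? ?] /andP[? ?] /andP[? ?].
  by exists j; rewrite ltr_norml; apply/andP; split; lra.
by exists k; rewrite ltr_norml; apply/andP; split; lra.
Qed.

(** The square of side [2 m] around the origin, a finite list that contains the ball. *)
Definition norm_ball (m : nat) : seq Z2 :=
  [seq (i, j) | i <- [seq k%:Z - m%:Z | k <- iota 0 (m + m).+1],
                j <- [seq k%:Z - m%:Z | k <- iota 0 (m + m).+1]].

Lemma mem_norm_ball (m : nat) (k : Z2) : (norm1 k <= m)%N -> k \in norm_ball m.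
Proof.
case: k => i j; rewrite /norm1 /= => km.
have mem (l : int) : (`|l| <= m)%N -> l \in [seq k%:Z - m%:Z | k <- iota 0 (m + m).+1].
  move=> lm; apply/mapP; exists `|(l + m%:Z)%R|%N; last by lia.
  by rewrite mem_iota; lia.
by apply/allpairsP; exists (i, j); split; rewrite ?mem //=;
  [exact: leq_trans (leq_addr _ _) km|exact: leq_trans (leq_addl _ _) km].
Qed.

Lemma torus_symbolic_representation : symbolic_representation P rot.
Proof.
move=> w /symbolic_wang hw.
have [x [y [v1 [v2 [X [Y [V [W [st hx hy hcode]]]]]]]]] := config_coding hw.
exists (torus_pi (x, y)); apply/seteqP; split=> [Q hQ|_ -> m _ B].
- rewrite -[Q]torus_reprK /=; apply/torus_piP.
  have [|h1 h2] := @cylinder_closure_eq w x y (repr Q).1 (repr Q).2 X Y V W st hx hy.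
    by move=> m; rewrite -surjective_pairing torus_reprK; exact: hQ.
  by rewrite /congrZ2 h1 h2.
(* The coding ray meets every cylinder and tends to [(x, y)]. *)
- move=> /torus_pi_continuous nB.
  have cv : (x + e * v1, y + e * v2) @[e --> (0:R)^'+] --> (x, y).
    exact: cvg_pair (@cvg_ray R x v1) (@cvg_ray R y v2).
  have [e [ce Be]] := filter_ex (filterI (hcode (norm_ball m)) (cv _ nB)).
  exists (torus_pi (x + e * v1, y + e * v2)); split => // k km.
  by apply/act_image/ce/mem_norm_ball.
Qed.

End Main.

Theorem theorem5 (R : realType) (n : nat) (hn : (1 <= n)%N) :
  metallic_wang_shift n
    = symbolic_system (metallic_partition R n) (rotation R n) /\
  markov_partition (metallic_partition R n) (rotation R n).
Proof.
have e : metallic_wang_shift n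
    = symbolic_system (metallic_partition R n) (rotation R n).
  by apply/seteqP; split=> w; [exact: wang_symbolic|exact: symbolic_wang].
split=> //; split.
- exact: torus_partition.
- exact: torus_symbolic_representation.
- by rewrite -e; exact: wang_finite_type.
Qed.
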